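(* Let $F$ be a finitely generated free group, $R$ a normal subgroup of $F$, and $G = F/R$. Let $L = F_1 *_R F_2$ be the double of $F$ along $R$, let $\pi \colon L \to G$ be the surjection obtained by killing $F_2$, let $\iota \colon L \to P$ be an embedding into a finitely generated group $P$, and let $\mathrm{Hig}_\iota(G)$ be the HNN extension with vertex group $P \times G$ and edge group $L$, conjugating the embeddings $\iota \times 1$ and $\iota \times \pi$. Suppose that $G$ is infinite and $R \neq 1$. Then $H_3(\mathrm{Hig}_\iota(G); \mathbb{Q})$ is infinite-dimensional over $\mathbb{Q}$; in particular $\mathrm{Hig}_\iota(G)$ is not of type $\mathrm{FP}_3(\mathbb{Q})$.
   Context: $F_1$ and $F_2$ are two copies of $F$, and $L = F_1 *_R F_2$ is the amalgamated free product identifying the copy of each $r \in R$ in $F_1$ with its copy in $F_2$. The map $\pi \colon L \to G$ is the homomorphism that restricts to the quotient map $F \to F/R = G$ on $F_1$ and is trivial on $F_2$. The embeddings $\iota \times 1, \iota \times \pi \colon L \to P \times G$ are $l \mapsto (\iota(l), 1)$ and $l \mapsto (\iota(l), \pi(l))$. The HNN extension $\mathrm{Hig}_\iota(G)$ is the group obtained from $P \times G$ by adding a stable letter $t$ and the relations $t\,(\iota(l),1)\,t^{-1} = (\iota(l), \pi(l))$ for all $l \in L$. $H_k(\,\cdot\,;\mathbb{Q})$ denotes group homology with trivial rational coefficients. A group $\Gamma$ is of type $\mathrm{FP}_n(\mathbb{Q})$ if the trivial $\mathbb{Q}\Gamma$-module $\mathbb{Q}$ admits a resolution $P_* \to \mathbb{Q}$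 by projective $\mathbb{Q}\Gamma$-modules with $P_i$ finitely generated for $0 \leq i \leq n$. *)

(* Defs.v *)
From HB Require Import structures.
From mathcomp Require Import all_boot all_order all_algebra.
From mathcomp Require Import finmap.
From mathcomp Require Import boolp classical_sets cardinality.
From mathcomp Require Import monalg.

Set Implicit Arguments.
Unset Strict Implicit.
Unset Printing Implicit Defensive.

Import GRing.Theory.

Local Open Scope classical_set_scope.
Local Open Scope quotient_scope.
Local Open Scope ring_scope.

Definition subgroup (G : groupType) (S : set G) : Prop :=
  [/\ S 1%g, (forall x y, S x -> S y -> S (x * y)%g) & forall x, S x -> S x^-1%g].

Definition group_generated_by (G : groupType) (s : seq G) : Prop :=
  forall S : set G, subgroup S -> (forall x, x \in s -> S x) -> S = setT.

Definition finitely_generated_group (G : groupType) : Prop :=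
  exists s : seq G, group_generated_by s.

Record normal_subgroup (G : groupType) := NormalSubgroup {
  nset :> G -> Prop;
  nset_subgroup : subgroup nset;
  nset_conj : forall x y, nset x -> nset (x ^ y)%g
}.

Section QuotientGroup.
Variables (G : groupType) (N : normal_subgroup G).

Definition coset_rel : rel G := fun x y => `[< N (x^-1 * y)%g >].

Lemma coset_rel_refl : reflexive coset_rel.
Proof. by move=> x; apply/asboolP; rewrite mulVg; case: (nset_subgroup N). Qed.

Lemma coset_rel_sym : symmetric coset_rel.
Proof.
have [_ _ NV] := nset_subgroup N.
by move=> x y; apply/asboolP/asboolP => /NV; rewrite invgM invgK.
Qed.

Lemma coset_rel_trans : transitive coset_rel.
Proof.
have [_ NM _] := nset_subgroup N.
move=> y x z /asboolP xy /asboolP yz; apply/asboolP.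
by have := NM _ _ xy yz; rewrite -mulgA mulVKg.
Qed.

Canonical coset_equiv := EquivRel coset_rel
  coset_rel_refl coset_rel_sym coset_rel_trans.

Definition quotient_group := {eq_quot coset_equiv}.
HB.instance Definition _ := Choice.on quotient_group.

Definition quotient_map (x : G) : quotient_group := \pi x.

Lemma quotient_mapP x y : N (x^-1 * y)%g <-> quotient_map x = quotient_map y.
Proof.
by split=> [h|/eqmodP/asboolP//]; apply/eqmodP/asboolP.
Qed.

Definition quotient_mul (a b : quotient_group) : quotient_group :=
  quotient_map (repr a * repr b)%g.
Definition quotient_one : quotient_group := quotient_map 1%g.
Definition quotient_inv (a : quotient_group) : quotient_group :=
  quotient_map (repr a)^-1%g.

Lemma quotient_mapK (a : quotient_group) : quotient_map (repr a) = a.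
Proof. exact: reprK. Qed.

Lemma quotient_mulE x y :
  quotient_mul (quotient_map x) (quotient_map y) = quotient_map (x * y)%g.
Proof.
have [_ NM _] := nset_subgroup N.
apply/quotient_mapP; set x' := repr _; set y' := repr _.
have xx : N (x'^-1 * x)%g by apply/quotient_mapP; rewrite quotient_mapK.
have yy : N (y'^-1 * y)%g by apply/quotient_mapP; rewrite quotient_mapK.
have := NM _ _ yy (nset_conj y xx).
by rewrite /conjg invgM !mulgA mulgK.
Qed.

Lemma quotient_invE x : quotient_inv (quotient_map x) = quotient_map x^-1%g.
Proof.
have [_ _ NV] := nset_subgroup N.
apply/quotient_mapP; set x' := repr _.
have xx : N (x'^-1 * x)%g by apply/quotient_mapP; rewrite quotient_mapK.
have := nset_conj x^-1%g (NV _ xx).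
by rewrite /conjg invgM !invgK !mulgA mulgV mul1g.
Qed.

Lemma quotient_mulA : associative quotient_mul.
Proof.
move=> a b c; rewrite -[a]quotient_mapK -[b]quotient_mapK -[c]quotient_mapK.
by rewrite !quotient_mulE mulgA.
Qed.
Lemma quotient_mul1g : left_id quotient_one quotient_mul.
Proof. by move=> a; rewrite -[a]quotient_mapK quotient_mulE mul1g. Qed.
Lemma quotient_mulg1 : right_id quotient_one quotient_mul.
Proof. by move=> a; rewrite -[a]quotient_mapK quotient_mulE mulg1. Qed.
Lemma quotient_mulVg : left_inverse quotient_one quotient_inv quotient_mul.
Proof.
by move=> a; rewrite -[a]quotient_mapK quotient_invE quotient_mulE mulVg.
Qed.
Lemma quotient_mulgV : right_inverse quotient_one quotient_inv quotient_mul.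
Proof.
by move=> a; rewrite -[a]quotient_mapK quotient_invE quotient_mulE mulgV.
Qed.

HB.instance Definition _ := isGroup.Build quotient_group
  quotient_mulA quotient_mul1g quotient_mulg1 quotient_mulVg quotient_mulgV.

Lemma quotient_map_is_morphism : monoid.monoid_morphism quotient_map.
Proof. by split=> // x y; rewrite -quotient_mulE. Qed.
HB.instance Definition _ :=
  isUMagmaMorphism.Build G quotient_group quotient_map quotient_map_is_morphism.

End QuotientGroup.

(* The letter (x, true) stands for the generator x and (x, false) for its
   inverse.  A relation [rel u v] imposes u = v. *)
Notation word X := (seq (X * bool)).

Section Presentation.
Variables (X : choiceType) (rel : word X -> word X -> Prop).

Inductive word_congr : word X -> word X -> Prop :=
| word_congr_rel u v : rel u v -> word_congr u v
| word_congr_cancel x b : word_congr [:: (x, b); (x, ~~ b)] [::]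
| word_congr_refl u : word_congr u u
| word_congr_sym u v : word_congr u v -> word_congr v u
| word_congr_trans u v w : word_congr u v -> word_congr v w -> word_congr u w
| word_congr_cat u u' v v' :
    word_congr u u' -> word_congr v v' -> word_congr (u ++ v) (u' ++ v').

Definition word_equivb : ssrbool.rel (word X) :=
  fun u v => `[< word_congr u v >].

Lemma word_equivb_refl : reflexive word_equivb.
Proof. by move=> u; apply/asboolP; apply: word_congr_refl. Qed.
Lemma word_equivb_sym : symmetric word_equivb.
Proof.
by move=> u v; apply/asboolP/asboolP => h; apply: word_congr_sym.
Qed.
Lemma word_equivb_trans : transitive word_equivb.
Proof.
move=> v u w /asboolP uv /asboolP vw; apply/asboolP.
exact: word_congr_trans uv vw.
Qed.

Canonical word_equiv := EquivRel word_equivb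
  word_equivb_refl word_equivb_sym word_equivb_trans.

Definition presented_group := {eq_quot word_equiv}.
HB.instance Definition _ := Choice.on presented_group.

Definition pres_class (w : word X) : presented_group := \pi w.

Lemma pres_classP u v : word_congr u v <-> pres_class u = pres_class v.
Proof. by split=> [h|/eqmodP/asboolP//]; apply/eqmodP/asboolP. Qed.

Lemma pres_classK (a : presented_group) : pres_class (repr a) = a.
Proof. exact: reprK. Qed.

Definition word_inv (w : word X) : word X :=
  rev [seq (a.1, ~~ a.2) | a <- w].

Lemma word_invK : involutive word_inv.
Proof.
move=> w; rewrite /word_inv map_rev revK -map_comp map_id_in // => -[x b] _.
by rewrite /= negbK.
Qed.

Lemma word_congr_mulV w : word_congr (w ++ word_inv w) [::].
Proof.
elim: w => [|[x b] w IH]; first exact: word_congr_refl.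
have -> : word_inv ((x, b) :: w) = word_inv w ++ [:: (x, ~~ b)].
  by rewrite /word_inv /= rev_cons cats1.
apply: word_congr_trans (word_congr_cancel x b).
apply: (@word_congr_cat [:: (x, b)] [:: (x, b)] _ [:: (x, ~~ b)]).
  exact: word_congr_refl.
rewrite -/(cat w (word_inv w ++ [:: (x, ~~ b)])) catA.
apply: (word_congr_cat (u' := [::])) => //.
exact: word_congr_refl.
Qed.

Lemma word_congr_mulVl w : word_congr (word_inv w ++ w) [::].
Proof. by have := word_congr_mulV (word_inv w); rewrite word_invK. Qed.

Lemma word_congr_inv u v :
  word_congr u v -> word_congr (word_inv u) (word_inv v).
Proof.
move=> uv; have r := word_congr_refl; have s := word_congr_sym.
apply: (@word_congr_trans _ (word_inv u ++ (v ++ word_inv v))).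
  rewrite -[X in word_congr X _]cats0; apply: word_congr_cat; first exact: r.
  by apply: s; apply: word_congr_mulV.
rewrite catA -[X in word_congr _ X]cat0s.
apply: word_congr_cat; last exact: r.
apply: word_congr_trans (word_congr_mulVl u).
by apply: word_congr_cat; [apply: r | apply: s].
Qed.

Definition pres_mul (a b : presented_group) : presented_group :=
  pres_class (repr a ++ repr b).
Definition pres_one : presented_group := pres_class [::].
Definition pres_inv (a : presented_group) : presented_group :=
  pres_class (word_inv (repr a)).

Lemma pres_mulE u v :
  pres_mul (pres_class u) (pres_class v) = pres_class (u ++ v).
Proof.
by apply/pres_classP; apply: word_congr_cat; apply/pres_classP;
  rewrite pres_classK.
Qed.

Lemma pres_invE u : pres_inv (pres_class u) = pres_class (word_inv u).
Proof.
by apply/pres_classP/word_congr_inv/pres_classP; rewrite pres_classK.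
Qed.

Lemma pres_mulA : associative pres_mul.
Proof.
move=> a b c; rewrite -[a]pres_classK -[b]pres_classK -[c]pres_classK.
by rewrite !pres_mulE catA.
Qed.
Lemma pres_mul1g : left_id pres_one pres_mul.
Proof. by move=> a; rewrite -[a]pres_classK pres_mulE. Qed.
Lemma pres_mulg1 : right_id pres_one pres_mul.
Proof. by move=> a; rewrite -[a]pres_classK pres_mulE cats0. Qed.
Lemma pres_mulVg : left_inverse pres_one pres_inv pres_mul.
Proof.
move=> a; rewrite -[a]pres_classK pres_invE pres_mulE.
by apply/pres_classP/word_congr_mulVl.
Qed.
Lemma pres_mulgV : right_inverse pres_one pres_inv pres_mul.
Proof.
move=> a; rewrite -[a]pres_classK pres_invE pres_mulE.
by apply/pres_classP/word_congr_mulV.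
Qed.

HB.instance Definition _ := isGroup.Build presented_group
  pres_mulA pres_mul1g pres_mulg1 pres_mulVg pres_mulgV.

Definition pres_gen (x : X) : presented_group := pres_class [:: (x, true)].

Lemma pres_classM u v : pres_class (u ++ v) = (pres_class u * pres_class v)%g.
Proof. by rewrite -pres_mulE. Qed.

End Presentation.

Section PresentationLift.
Variables (X : choiceType) (H : groupType) (f : X -> H).

Definition word_eval (w : word X) : H :=
  (\prod_(a <- w) (if a.2 then f a.1 else (f a.1)^-1))%g.

Lemma word_eval_cat u v : word_eval (u ++ v) = (word_eval u * word_eval v)%g.
Proof. exact: big_cat. Qed.

Variable rel : word X -> word X -> Prop.
Hypothesis rel_f : forall u v, rel u v -> word_eval u = word_eval v.

Lemma word_eval_congr u v : word_congr rel u v -> word_eval u = word_eval v.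
Proof.
elim=> {u v} [u v /rel_f|x b| | |u v w _ -> _ ->|u u' v v' _ E _ E'] //.
  by rewrite /word_eval !big_cons big_nil mulg1; case: b;
    rewrite ?mulgV ?mulVg.
by rewrite !word_eval_cat E E'.
Qed.

Definition pres_lift (a : presented_group rel) : H := word_eval (repr a).

Lemma pres_liftE w : pres_lift (pres_class rel w) = word_eval w.
Proof. by apply/word_eval_congr/pres_classP; rewrite pres_classK. Qed.

Lemma pres_lift_gen x : pres_lift (pres_gen rel x) = f x.
Proof. by rewrite pres_liftE /word_eval big_seq1. Qed.

Lemma pres_lift_is_morphism : monoid.monoid_morphism pres_lift.
Proof.
split=> [|a b]; first by rewrite [LHS]pres_liftE /word_eval big_nil.
rewrite -[a]pres_classK -[b]pres_classK -pres_classM !pres_liftE.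
exact: word_eval_cat.
Qed.

End PresentationLift.

Definition group_isomorphic (G H : groupType) : Prop :=
  exists f : UMagmaMorphism.type G H, bijective f.

Definition free_group (X : choiceType) : groupType :=
  presented_group (fun _ _ : word X => False).

Definition is_free_group (F : groupType) : Prop :=
  exists X : choiceType, group_isomorphic (free_group X) F.

Section Double.
Variables (F : groupType) (R : normal_subgroup F).

(* Both copies of F are presented by their multiplication tables, and the two
   copies of each element of R are identified. *)
Inductive double_rel : word (F + F)%type -> word (F + F)%type -> Prop :=
| double_rel_mul1 x y :
    double_rel [:: (inl x, true); (inl y, true)] [:: (inl (x * y)%g, true)]
| double_rel_mul2 x y :
    double_rel [:: (inr x, true); (inr y, true)] [:: (inr (x * y)%g, true)]
| double_rel_amalg r :
    R r -> double_rel [:: (inl r, true)] [:: (inr r, true)].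

Definition group_double : groupType := presented_group double_rel.

Definition double_pi_gen (z : F + F) : quotient_group R :=
  match z with inl x => quotient_map R x | inr _ => 1%g end.

Lemma double_pi_genP u v :
  double_rel u v -> word_eval double_pi_gen u = word_eval double_pi_gen v.
Proof.
have [R1 RM RV] := nset_subgroup R.
case=> [x y|x y|r Rr]; rewrite /word_eval !(big_cons, big_nil) /= ?mulg1 //.
  by rewrite gmulfM.
change (quotient_map R r = quotient_map R 1%g).
by apply/quotient_mapP; rewrite mulg1; apply: RV.
Qed.

Definition double_pi (l : group_double) : quotient_group R :=
  pres_lift double_pi_gen l.

HB.instance Definition _ := isUMagmaMorphism.Build group_double (quotient_group R)
  double_pi (pres_lift_is_morphism double_pi_genP).

End Double.

Section HNN.
Variables (V E : groupType) (a b : E -> V).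

Local Notation letter v := (inl v, true).
Local Notation stable e := (inr tt, e).

(* V is presented by its multiplication table; [inr tt] is the stable letter
   t, and the second family of relations reads t (a e) t^-1 = b e. *)
Inductive hnn_rel : word (V + unit)%type -> word (V + unit)%type -> Prop :=
| hnn_rel_mul v w :
    hnn_rel [:: letter v; letter w] [:: letter (v * w)%g]
| hnn_rel_conj e :
    hnn_rel [:: stable true; letter (a e); stable false] [:: letter (b e)].

Definition hnn_extension : groupType := presented_group hnn_rel.

End HNN.

Definition Hig (F : groupType) (R : normal_subgroup F) (P : groupType)
    (iota : group_double R -> P) : groupType :=
  @hnn_extension (P * quotient_group R)%type (group_double R)
    (fun l => (iota l, 1%g)) (fun l => (iota l, double_pi l)).

Definition finitely_generated_module (A : nzRingType) (M : lmodType A) : Prop :=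
  exists s : seq M, forall m : M,
    exists c : 'I_(size s) -> A, m = \sum_i c i *: s`_i.

Definition finite_dimensional (K : fieldType) (V : lmodType K) : Prop :=
  finitely_generated_module V.

Definition surjective (S T : Type) (f : S -> T) : Prop :=
  forall y, exists x, f x = y.

Definition projective_module (A : nzRingType) (P : lmodType A) : Prop :=
  forall (M N : lmodType A) (p : {linear M -> N}) (f : {linear P -> N}),
    surjective p -> exists g : {linear P -> M}, forall x, p (g x) = f x.

Record projective_resolution (A : nzRingType) (M : lmodType A) := ProjRes {
  res_mod :> nat -> lmodType A;
  res_diff : forall i, {linear res_mod i.+1 -> res_mod i};
  res_aug : {linear res_mod 0%N -> M};
  res_proj : forall i, projective_module (res_mod i);
  res_aug_surj : surjective res_aug;
  res_exact0 : forall x, res_aug x = 0 <-> exists y, res_diff 0 y = x;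
  res_exact : forall i x, res_diff i x = 0 <-> exists y, res_diff i.+1 y = x
}.

Section LinearExtension.
Variables (K : choiceType) (V : lmodType rat).

Definition lin_ext (f : K -> V) (c : {malg rat[K]}) : V :=
  \sum_(k <- msupp c) c@_k *: f k.

Variable f : K -> V.

Lemma lin_extEw (d : {fset K}) c :
  (msupp c `<=` d)%fset -> lin_ext f c = \sum_(k <- d) c@_k *: f k.
Proof.
move=> cd; rewrite /lin_ext (big_fset_incl _ cd) //= => k _ /mcoeff_outdom ->.
by rewrite scale0r.
Qed.

Lemma lin_ext_is_linear : linear (lin_ext f).
Proof.
move=> a u v; pose d := (msupp u `|` msupp v)%fset.
rewrite (@lin_extEw d u) ?fsubsetUl // (@lin_extEw d v) ?fsubsetUr //.
rewrite (@lin_extEw d); last first.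
  apply: fsubset_trans (msuppD_le _ _) _.
  exact/fsetSU/msuppZ_le.
rewrite scaler_sumr -big_split /=; apply: eq_bigr => k _.
by rewrite mcoeffD mcoeffZ scalerDl scalerA.
Qed.

HB.instance Definition _ :=
  GRing.isLinear.Build rat {malg rat[K]} V _ (lin_ext f) lin_ext_is_linear.

Lemma lin_extU k : lin_ext f << k >> = f k.
Proof.
rewrite (@lin_extEw [fset k]%fset) ?msuppU_le //.
by rewrite big_seq_fset1 mcoeffUU scale1r.
Qed.

End LinearExtension.

Lemma malg_ind (K : choiceType) (Q : {malg rat[K]} -> Prop) :
  Q 0 -> (forall k, Q << k >>) ->
  (forall a u v, Q u -> Q v -> Q (a *: u + v)) -> forall c, Q c.
Proof.
move=> Q0 QU QD c; rewrite [c]monalgE; elim/big_rec: _ => // k u _ Qu.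
suff -> : << c@_k *g k >> = c@_k *: << k >> by apply: QD.
by apply/malgP => k'; rewrite mcoeffZ !mcoeffU mulrnAr mulr1.
Qed.

(* [monalg] only equips {malg rat[K]} with a product when no nontrivial element
   of the monoid K is invertible, so the convolution product is defined here. *)
Definition group_algebra (G : groupType) : Type := {malg rat[G]}.

Section GroupAlgebra.
Variable G : groupType.
Local Notation A := (group_algebra G).

HB.instance Definition _ := GRing.Lmodule.on A.

Definition galg_elt (g : G) : A := << g >>.

Definition galg_mul (x y : A) : A :=
  lin_ext (fun g => lin_ext (fun h => galg_elt (g * h)%g) y) x.

Lemma galg_mulPl a x y z :
  galg_mul (a *: x + y) z = a *: galg_mul x z + galg_mul y z.
Proof. exact: linearP. Qed.

Lemma galg_mulPr a x y z :
  galg_mul x (a *: y + z) = a *: galg_mul x y + galg_mul x z.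
Proof.
rewrite /galg_mul /lin_ext -/(lin_ext _) scaler_sumr -big_split /=.
apply: eq_bigr => g _; rewrite -/(lin_ext _ _) linearP scalerDr !scalerA.
by rewrite mulrC.
Qed.

Lemma galg_mul0l y : galg_mul 0 y = 0.
Proof. exact: linear0. Qed.

Lemma galg_mul0r x : galg_mul x 0 = 0.
Proof.
by have := galg_mulPr (-1) x 0 0; rewrite scaleN1r oppr0 addr0 scaleN1r addNr.
Qed.

Lemma galg_mulU g h :
  galg_mul (galg_elt g) (galg_elt h) = galg_elt (g * h)%g.
Proof. by rewrite /galg_mul !lin_extU. Qed.

Lemma galg_mulA : associative galg_mul.
Proof.
move=> x y z; elim/malg_ind: x => [|g|a u v IHu IHv].
- by rewrite !galg_mul0l.
- elim/malg_ind: y => [|h|a u v IHu IHv].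
  + by rewrite galg_mul0l galg_mul0r galg_mul0l.
  + elim/malg_ind: z => [|k|a u v IHu IHv].
    * by rewrite !galg_mul0r.
    * by rewrite !galg_mulU mulgA.
    * by rewrite !galg_mulPr IHu IHv.
  + by rewrite galg_mulPl !galg_mulPr galg_mulPl IHu IHv.
- by rewrite !galg_mulPl IHu IHv.
Qed.

Lemma galg_mul1l : left_id (galg_elt 1%g) galg_mul.
Proof.
elim/malg_ind=> [|g|a u v IHu IHv]; first exact: galg_mul0r.
  by rewrite galg_mulU mul1g.
by rewrite galg_mulPr IHu IHv.
Qed.

Lemma galg_mul1r : right_id (galg_elt 1%g) galg_mul.
Proof.
elim/malg_ind=> [|g|a u v IHu IHv]; first exact: galg_mul0l.
  by rewrite galg_mulU mulg1.
by rewrite galg_mulPl IHu IHv.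
Qed.

Lemma galg_mulDl : left_distributive galg_mul +%R.
Proof.
by move=> x y z; rewrite -[x in LHS]scale1r galg_mulPl scale1r.
Qed.

Lemma galg_mulDr : right_distributive galg_mul +%R.
Proof.
by move=> x y z; rewrite -[y in LHS]scale1r galg_mulPr scale1r.
Qed.

Lemma galg_1neq0 : galg_elt 1%g != 0.
Proof. by rewrite monalgU_eq0 oner_neq0. Qed.

HB.instance Definition _ := GRing.Zmodule_isNzRing.Build A
  galg_mulA galg_mul1l galg_mul1r galg_mulDl galg_mulDr galg_1neq0.

Definition augmentation (x : A) : rat := lin_ext (fun _ => 1 : rat^o) x.

Lemma augmentation_elt g : augmentation (galg_elt g) = 1.
Proof. by rewrite /augmentation lin_extU. Qed.

Lemma augmentationP a x y :
  augmentation (a *: x + y) = a * augmentation x + augmentation y.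
Proof. exact: (linearP (lin_ext (fun _ : G => 1 : rat^o))). Qed.

Lemma augmentation1 : augmentation 1 = 1.
Proof. exact: augmentation_elt. Qed.

Lemma augmentationD x y : augmentation (x + y) = augmentation x + augmentation y.
Proof. by have := augmentationP 1 x y; rewrite scale1r mul1r. Qed.

Lemma augmentation0 : augmentation 0 = 0.
Proof. exact: (linear0 (lin_ext (fun _ : G => 1 : rat^o))). Qed.

Lemma augmentationM x y : augmentation (x * y) = augmentation x * augmentation y.
Proof.
rewrite -[x * y]/(galg_mul x y); elim/malg_ind: x => [|g|a u v IHu IHv].
- by rewrite galg_mul0l augmentation0 mul0r.
- elim/malg_ind: y => [|h|a u v IHu IHv].
  + by rewrite galg_mul0r augmentation0 mulr0.
  + by rewrite galg_mulU !augmentation_elt mulr1.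
  + by rewrite galg_mulPr !augmentationP IHu IHv mulrDr mulrCA.
- by rewrite galg_mulPl !augmentationP IHu IHv mulrDl mulrA.
Qed.

End GroupAlgebra.

(* The rational numbers with every element of G acting as the identity. *)
Definition trivial_module (G : groupType) : Type := rat.

Section TrivialModule.
Variable G : groupType.
Local Notation A := (group_algebra G).
Local Notation trivial_module := (trivial_module G).

HB.instance Definition _ := GRing.Zmodule.on trivial_module.

Definition trivial_scale (x : A) (q : trivial_module) : trivial_module :=
  augmentation x * q.

Lemma trivial_scaleA x y q :
  trivial_scale x (trivial_scale y q) = trivial_scale (x * y) q.
Proof. by rewrite /trivial_scale augmentationM mulrA. Qed.
Lemma trivial_scale1 : left_id 1 trivial_scale.
Proof. by move=> q; rewrite /trivial_scale augmentation1 mul1r. Qed.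
Lemma trivial_scaleDr : right_distributive trivial_scale +%R.
Proof. by move=> x p q; apply: mulrDr. Qed.
Lemma trivial_scaleDl q : {morph trivial_scale^~ q : x y / x + y}.
Proof. by move=> x y; rewrite /trivial_scale augmentationD mulrDl. Qed.

HB.instance Definition _ := GRing.Zmodule_isLmodule.Build A trivial_module
  trivial_scaleA trivial_scale1 trivial_scaleDr trivial_scaleDl.

End TrivialModule.

(* [lmodType (group_algebra G)] is the type of left modules. *)
Definition type_FP_Q (n : nat) (G : groupType) : Prop :=
  exists P : projective_resolution (trivial_module G),
    forall i, (i <= n)%N -> finitely_generated_module (P i).

Section QuotientModule.
Variables (V : lmodType rat) (B : {pred V}) (B_submod : submod_closed B).

Definition submod_pred of submod_closed B : {pred V} := B.
HB.instance Definition _ := GRing.isZmodClosed.Build V (submod_pred B_submod)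
  (GRing.submod_closedB B_submod).

Definition quotient_module : Type := Quotient.quot (submod_pred B_submod).
HB.instance Definition _ := GRing.Zmodule.on quotient_module.

Definition quotient_module_proj (v : V) : quotient_module :=
  \pi_(Quotient.quot (submod_pred B_submod)) v.

Lemma quotient_module_projP u v :
  u - v \in B <-> quotient_module_proj u = quotient_module_proj v.
Proof.
rewrite -[u - v \in B]/(u - v \in submod_pred B_submod) Quotient.idealrBE.
by split=> /eqP.
Qed.

Lemma quotient_module_projD u v : quotient_module_proj (u + v) =
  quotient_module_proj u + quotient_module_proj v.
Proof. exact: Quotient.pi_add. Qed.

Definition quotient_scale (a : rat) (x : quotient_module) : quotient_module :=
  quotient_module_proj (a *: repr x).

Lemma quotient_module_projK (x : quotient_module) :
  quotient_module_proj (repr x) = x.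
Proof. exact: reprK. Qed.

Lemma quotient_scaleE a v :
  quotient_scale a (quotient_module_proj v) = quotient_module_proj (a *: v).
Proof.
apply/quotient_module_projP; rewrite -scalerBr.
apply: (GRing.subsemimod_closedZ (GRing.submod_closed_semi B_submod)).
by apply/quotient_module_projP; rewrite quotient_module_projK.
Qed.

Lemma quotient_scaleA a b x :
  quotient_scale a (quotient_scale b x) = quotient_scale (a * b) x.
Proof.
by rewrite -[x]quotient_module_projK !quotient_scaleE scalerA.
Qed.
Lemma quotient_scale1 : left_id 1 quotient_scale.
Proof.
by move=> x; rewrite -[x]quotient_module_projK quotient_scaleE scale1r.
Qed.
Lemma quotient_scaleDr : right_distributive quotient_scale +%R.
Proof.
move=> a x y; rewrite -[x]quotient_module_projK -[y]quotient_module_projK.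
by rewrite -quotient_module_projD !quotient_scaleE scalerDr quotient_module_projD.
Qed.
Lemma quotient_scaleDl x : {morph quotient_scale^~ x : a b / a + b}.
Proof.
move=> a b; rewrite -[x]quotient_module_projK !quotient_scaleE scalerDl.
exact: quotient_module_projD.
Qed.

HB.instance Definition _ := GRing.Zmodule_isLmodule.Build rat quotient_module
  quotient_scaleA quotient_scale1 quotient_scaleDr quotient_scaleDl.

End QuotientModule.

Section GroupHomology.
Variable G : groupType.

(* The inhomogeneous bar complex with coefficients in the trivial module Q:
   bar n is the rational vector space with basis the n-tuples
   [g_0 | ... | g_(n-1)] of elements of G. *)
Definition bar (n : nat) : lmodType rat := {malg rat[{ffun 'I_n -> G}]}.

(* The k-th face of [g_0 | ... | g_n]: it drops g_0 when k = 0, replaces the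
   pair g_(k-1), g_k by its product when 0 < k <= n, and drops g_n when
   k = n + 1. *)
Definition bar_face n (k : 'I_n.+2) (g : {ffun 'I_n.+1 -> G}) :
    {ffun 'I_n -> G} :=
  [ffun i : 'I_n =>
    let g_i := g (widen_ord (leqnSn n) i) in
    let g_Si := g (lift ord0 i) in
    if (i.+1 < k)%N then g_i
    else if i.+1 == k :> nat then (g_i * g_Si)%g
    else g_Si].

Definition bar_diff n : {linear bar n.+1 -> bar n} :=
  lin_ext (fun g => \sum_(k < n.+2) (-1) ^+ k *: (<< bar_face k g >> : bar n)).

Definition bar_cycle n : {pred bar n} :=
  match n with 0 => predT | m.+1 => fun c => bar_diff m c == 0 end.

Lemma bar_cycle_submod n : submod_closed (@bar_cycle n).
Proof.
case: n => [|n]; first by split.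
split=> [|a u v]; first by rewrite unfold_in /= linear0.
rewrite !unfold_in => /eqP u0 /eqP v0; apply/eqP.
by rewrite linearP [bar_diff n u]u0 [bar_diff n v]v0 scaler0 addr0.
Qed.
HB.instance Definition _ n :=
  GRing.isSubmodClosed.Build rat (bar n) (@bar_cycle n) (@bar_cycle_submod n).

Record bar_cycles n := BarCycles {
  bar_cycle_val :> bar n;
  _ : bar_cycle_val \in @bar_cycle n
}.
HB.instance Definition _ n := [isSub for @bar_cycle_val n].
HB.instance Definition _ n := [Choice of bar_cycles n by <:].
HB.instance Definition _ n := [SubChoice_isSubLmodule of bar_cycles n by <:].

Definition bar_boundary n : {pred bar_cycles n} :=
  fun z => `[< exists c, bar_diff n c = val z >].

Lemma bar_boundary_submod n : submod_closed (@bar_boundary n).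
Proof.
split=> [|a u v]; first by apply/asboolP; exists 0; rewrite !linear0.
move=> /asboolP[c cu] /asboolP[d dv]; apply/asboolP; exists (a *: c + d).
by rewrite !linearP /= cu dv.
Qed.

Definition group_homology (n : nat) : lmodType rat :=
  quotient_module (@bar_boundary_submod n).

End GroupHomology.

(* Main.v *)
(* Write G = F/R, A = QG, and let t be the stable letter of Hig.

   Cycles.  For f in F, the element k = f_2^-1 f_1 of L commutes with every r in
   R, so (k, r) spans a torus in L.  Its two images in P x G, which t conjugates
   into each other, differ by the torus of (f, r) in G x P.  When r = [h, r_0]
   with h in F and r_0 in R, this last torus bounds, because r is already a
   commutator in L, hence in P.  Closing up the prism swept out by t gives a
   3-cycle Z(f, h, r_0).

   Detection.  Let D : F -> A be a Fox derivative.  The boundary maps of the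
   Mayer-Vietoris sequences of the HNN extension and of the double, followed by
   D, are represented by an explicit A-valued 3-cocycle, whose value on
   Z(f, h, r_0) is (1 - f)(h - 1) D(r_0).

   Conclusion.  A shortest nontrivial element r_0 of R traces a simple closed
   path in the Cayley graph of G, so D(r_0) <> 0 for a suitable D.  As G is
   infinite, h can be chosen with (h - 1) D(r_0) <> 0, and then no finite subset
   of G supports all the (1 - f)(h - 1) D(r_0).  So H_3 is not finite
   dimensional.  Comparing the bar resolution with a resolution that is finitely
   generated in degree 3 shows that FP_3(Q) would make H_3 finite
   dimensional. *)

Require Import Defs.
From HB Require Import structures.
From mathcomp Require Import all_boot all_order all_algebra.
From mathcomp Require Import finmap.
From mathcomp Require Import boolp classical_sets functions cardinality.
From mathcomp Require Import monalg.

Set Implicit Arguments.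
Unset Strict Implicit.
Unset Printing Implicit Defensive.

Import GRing.Theory.

Local Open Scope classical_set_scope.
Local Open Scope ring_scope.

(** * Actions and cocycles of presented groups *)

Section WordCongr.
Variables (X : choiceType) (rel : word X -> word X -> Prop).
Local Notation Gamma := (presented_group rel).
Local Notation cls := (pres_class rel).
Local Notation gen := (pres_gen rel).

Lemma pres_class_nil : cls [::] = 1%g.
Proof. by []. Qed.

Lemma pres_class_letter x b :
  cls [:: (x, b)] = (if b then gen x else (gen x)^-1)%g.
Proof.
case: b => //; apply/esym/mulg1_eq; rewrite -pres_classM -pres_class_nil.
by apply/pres_classP; apply: word_congr_cancel.
Qed.

Lemma pres_class_cons x b w :
  cls ((x, b) :: w) = ((if b then gen x else (gen x)^-1) * cls w)%g.
Proof. by rewrite -cat1s pres_classM pres_class_letter. Qed.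

Lemma pres_class_eval w : cls w = word_eval gen w.
Proof.
elim: w => [|[x b] w IHw]; rewrite /word_eval ?big_nil //.
by rewrite pres_class_cons big_cons IHw.
Qed.

Lemma pres_class_rel u v : rel u v -> cls u = cls v.
Proof. by move=> uv; apply/pres_classP; apply: word_congr_rel. Qed.

Section Action.
Variables (A : Type) (f f' : X -> A -> A).
Hypotheses (fK : forall x, cancel (f x) (f' x))
           (f'K : forall x, cancel (f' x) (f x)).

Definition word_act (w : word X) (a : A) : A :=
  foldr (fun l a => if l.2 then f l.1 a else f' l.1 a) a w.

Lemma word_act_cat u v a : word_act (u ++ v) a = word_act u (word_act v a).
Proof. exact: foldr_cat. Qed.

Hypothesis rel_act : forall u v, rel u v -> word_act u =1 word_act v.

Lemma word_act_congr u v : word_congr rel u v -> word_act u =1 word_act v.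
Proof.
elim=> {u v} [u v /rel_act|x b a| |u v _ IH a|u v w _ IH _ IH' a|] //.
- by case: b; rewrite /= ?fK ?f'K.
- by rewrite IH IH'.
by move=> u u' v v' _ IH _ IH' a; rewrite !word_act_cat IH IH'.
Qed.

Lemma pres_action : exists act : Gamma -> A -> A,
  [/\ forall a, act 1%g a = a,
      forall g h a, act (g * h)%g a = act g (act h a)
    & forall x a, act (gen x) a = f x a].
Proof.
have actE w a : word_act (repr (cls w)) a = word_act w a.
  by apply/word_act_congr/pres_classP; rewrite pres_classK.
exists (fun g => word_act (repr g)); split=> [a|g h a|x a]; rewrite ?actE //.
exact: word_act_cat.
Qed.

End Action.

(* A right cocycle T amounts to the action (u, w) |-> (g u, w + T g u) on
   U x W; the relations need only be respected on the invariant part [inv]. *)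
Section RightCocycle.
Variables (U W : zmodType) (act : Gamma -> U -> U) (inv : U -> Prop).
Hypotheses (act1 : forall u, act 1%g u = u)
  (actM : forall g h u, act (g * h)%g u = act g (act h u))
  (actD : forall g u v, act g (u + v) = act g u + act g v)
  (inv_act : forall g u, inv u -> inv (act g u)).
Variable T0 : X -> U -> W.
Hypothesis T0D : forall x u v, inv u -> inv v -> T0 x (u + v) = T0 x u + T0 x v.

(** On an inverse letter the value is forced by the cocycle identity for x x^-1 = 1, which gives T
    x^-1 v = - T x (x^-1 v). *)
Fixpoint word_cocycle (w : word X) (u : U) : W :=
  if w is (x, b) :: w' then
    (if b then T0 x (act (cls w') u)
     else - T0 x (act ((gen x)^-1 * cls w')%g u)) + word_cocycle w' u
  else 0.

Lemma word_cocycle1 x u : word_cocycle [:: (x, true)] u = T0 x u.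
Proof. by rewrite /= addr0 pres_class_nil act1. Qed.

Lemma word_cocycle_cons x w u : word_cocycle ((x, true) :: w) u =
  T0 x (act (cls w) u) + word_cocycle w u.
Proof. by []. Qed.

Lemma word_cocycle_cat w1 w2 u : word_cocycle (w1 ++ w2) u =
  word_cocycle w1 (act (cls w2) u) + word_cocycle w2 u.
Proof.
elim: w1 => [|[x b] w1 IH] /=; first by rewrite add0r.
by rewrite IH addrA pres_classM -!actM mulgA.
Qed.

Hypothesis rel_cocycle : forall w1 w2 u, rel w1 w2 -> inv u ->
  word_cocycle w1 u = word_cocycle w2 u.

Lemma word_cocycle_congr w1 w2 u : word_congr rel w1 w2 -> inv u ->
  word_cocycle w1 u = word_cocycle w2 u.
Proof.
move=> c; elim: c u => {w1 w2}; first by move=> *; apply: rel_cocycle.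
- move=> x b u _; rewrite /= addr0 pres_class_letter /= mulg1.
  by case: b; rewrite /= ?pres_class_nil ?act1 ?mulgV ?mulVg ?act1 ?subrr ?addNr.
- by [].
- by move=> w1 w2 _ IH u iu; rewrite IH.
- by move=> w1 w2 w3 _ IH _ IH' u iu; rewrite IH // IH'.
move=> w1 w1' w2 w2' _ IH c IH' u iu; rewrite !word_cocycle_cat IH' //.
have -> : cls w2 = cls w2' by apply/pres_classP.
by rewrite IH //; apply: inv_act.
Qed.

Lemma pres_right_cocycle : exists T : Gamma -> U -> W,
  [/\ forall g h u, inv u -> T (g * h)%g u = T g (act h u) + T h u,
      forall g u v, inv u -> inv v -> T g (u + v) = T g u + T g v
    & forall x u, inv u -> T (gen x) u = T0 x u].
Proof.
have TE w u : inv u -> word_cocycle (repr (cls w)) u = word_cocycle w u.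
  by move=> iu; apply: word_cocycle_congr => //; apply/pres_classP; rewrite pres_classK.
exists (fun g => word_cocycle (repr g)); split=> [g h u iu|g u v iu iv|x u iu].
- rewrite -{1}(pres_classK g) -{1}(pres_classK h) -pres_classM TE //.
  by rewrite word_cocycle_cat pres_classK.
- elim: (repr g) => [|[x b] w IH] /=; first by rewrite addr0.
  rewrite IH addrACA; congr (_ + _).
  by case: b; rewrite actD T0D ?opprD //; apply: inv_act.
by rewrite TE //= addr0 pres_class_nil act1.
Qed.

End RightCocycle.

End WordCongr.

(** * Fox derivatives *)

Section GroupAlgebraCoef.
Variable G : groupType.
Implicit Types (g h u : G) (a b : group_algebra G).

Lemma galg_eltM g h : galg_elt (g * h)%g = galg_elt g * galg_elt h.
Proof. by rewrite -galg_mulU. Qed.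

Lemma galg_elt1 : galg_elt (1%g : G) = 1.
Proof. by []. Qed.

Lemma galg_coefD a b u : (a + b)@_u = a@_u + b@_u.
Proof. exact: mcoeffD. Qed.

Lemma galg_coefN a u : (- a)@_u = - a@_u.
Proof. exact: mcoeffN. Qed.

Lemma galg_coef_elt g u : (galg_elt g)@_u = (g == u)%:R.
Proof. exact: mcoeffU. Qed.

Lemma galg_coef0 u : (0 : group_algebra G)@_u = 0.
Proof. exact: mcoeff0. Qed.

Lemma galg_coef_mull g a u : (galg_elt g * a)@_u = a@_(g^-1 * u)%g.
Proof.
elim/malg_ind: a => [|h|c a b IHa IHb].
- by rewrite mulr0 !galg_coef0.
- rewrite -/(galg_elt h) -galg_eltM !galg_coef_elt; congr (nat_of_bool _)%:R.
  by apply/idP/idP => /eqP => [<-|->]; rewrite ?mulKg ?mulVKg.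
by rewrite [_ * _]galg_mulPr !(mcoeffD, mcoeffZ) IHa IHb.
Qed.

End GroupAlgebraCoef.

Section FoxDerivative.
Variables (X : choiceType) (G : groupType) (q : X -> G) (x0 : X).
Local Notation ev := (word_eval q).

(** The Fox derivative with respect to the generator [x0], pushed forward to Q[G] along [q]. The
    value on the inverse letter is forced by the product rule for x0 x0^-1 = 1. *)
Definition fox_letter (l : X * bool) : group_algebra G :=
  if l.1 == x0 then (if l.2 then 1 else - galg_elt (q x0)^-1%g) else 0.

Fixpoint fox_word (w : word X) : group_algebra G :=
  if w is l :: w' then fox_letter l + galg_elt (ev [:: l]) * fox_word w' else 0.

Lemma word_eval_cons l w : ev (l :: w) = (ev [:: l] * ev w)%g.
Proof. by rewrite -cat1s word_eval_cat. Qed.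

Lemma fox_word_cat u v :
  fox_word (u ++ v) = fox_word u + galg_elt (ev u) * fox_word v.
Proof.
elim: u => [|l u IH] /=; first by rewrite add0r /word_eval big_nil mul1r.
by rewrite IH mulrDr mulrA -galg_eltM -word_eval_cons addrA.
Qed.

Lemma word_eval_letter x b :
  ev [:: (x, b)] = (if b then q x else (q x)^-1)%g.
Proof. exact: big_seq1. Qed.

Lemma fox_word_congr u v :
  word_congr (fun _ _ => False) u v -> fox_word u = fox_word v.
Proof.
elim=> {u v} [//|x b| |//|u v w _ -> _ ->|u u' v v' c IH _ IH'] //.
  rewrite /= mulr0 addr0 /fox_letter /= word_eval_letter.
  case: eqP => [->|_]; last by rewrite add0r mulr0.
  by case: b; rewrite /= ?mulr1 ?addNr // mulrN -galg_eltM mulgV subrr.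
rewrite !fox_word_cat IH IH'; congr (_ + galg_elt _ * _).
by apply: word_eval_congr c.
Qed.

(* Each occurrence of [x0] in a word contributes the prefix that ends at the
   tail of the edge of the Cayley graph that it crosses. *)
Lemma fox_word_coef w u : (fox_word w)@_u != 0 ->
  exists w1 b w2, w = w1 ++ (x0, b) :: w2 /\
    u = ev (if b then w1 else rcons w1 (x0, b)).
Proof.
elim: w u => [|l w IH] u /=; first by rewrite galg_coef0 eqxx.
have [fl0|fl] := eqVneq ((fox_letter l)@_u) 0.
  rewrite galg_coefD fl0 add0r galg_coef_mull => /IH[w1 [b [w2 [-> uE]]]].
  exists (l :: w1), b, w2; split => //.
  have -> : ev (if b then l :: w1 else rcons (l :: w1) (x0, b)) =
    (ev [:: l] * ev (if b then w1 else rcons w1 (x0, b)))%g.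
    by case: b {uE}; rewrite ?rcons_cons word_eval_cons.
  by rewrite -uE mulVKg.
move=> _; move: fl; rewrite /fox_letter; case: l => x b /=.
case: (x =P x0) => [->|_]; last by rewrite galg_coef0 eqxx.
move=> fl; exists [::], b, w; split => //; move: fl; case: b.
  rewrite -galg_elt1 galg_coef_elt /word_eval big_nil.
  by have [->|_] := eqVneq 1%g u; rewrite ?eqxx.
rewrite galg_coefN oppr_eq0 galg_coef_elt /= word_eval_letter.
by have [->|_] := eqVneq (q x0)^-1%g u; rewrite ?eqxx.
Qed.

End FoxDerivative.

Lemma quotient_map_eq1 (F : groupType) (R : normal_subgroup F) x :
  quotient_map R x = 1%g <-> R x.
Proof.
have [_ _ RV] := nset_subgroup R.
rewrite -[1%g]/(quotient_map R 1%g); split=> [/esym/quotient_mapP|Rx].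
  by rewrite invg1 mul1g.
by apply/esym/quotient_mapP; rewrite invg1 mul1g.
Qed.

Lemma word_eval_morph (X : choiceType) (G H : groupType)
    (f : UMagmaMorphism.type G H) (q : X -> G) w :
  f (word_eval q w) = word_eval (f \o q) w.
Proof.
rewrite /word_eval gmulf_prod; apply: eq_bigr => -[x b] _ /=.
by case: b => //; rewrite gmulfV.
Qed.

(** Trades the isomorphism for a map [q] of generators, so that a function of words invariant under
    free cancellation descends to F. *)
Lemma free_group_eval (F : groupType) : is_free_group F ->
  exists (X : choiceType) (q : X -> F),
    (forall x, exists w, word_eval q w = x) /\
    (forall u v, word_eval q u = word_eval q v ->
       word_congr (fun _ _ => False) u v).
Proof.
move=> [X [f [f' fK f'K]]]; pose rel0 := fun _ _ : word X => False.
have fE w : f (pres_class rel0 w) = word_eval (f \o pres_gen rel0) w.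
  by rewrite pres_class_eval word_eval_morph.
exists X, (f \o pres_gen rel0); split=> [x|u v].
  by exists (repr (f' x)); rewrite -fE pres_classK f'K.
by rewrite -!fE => /(can_inj fK)/pres_classP.
Qed.

(** * A Fox derivative that does not vanish on R *)

Section RelationModule.
Variables (F : groupType) (R : normal_subgroup F).
Local Notation bar x := (galg_elt (quotient_map R x)).

(** The relator is a shortest word representing a nontrivial element of R. Its positive first letter
    makes the first term of its Fox derivative equal to 1. *)
Lemma minimal_relator (X : choiceType) (q : X -> F) :
    (forall x, exists w, word_eval q w = x) -> nset R <> [set 1%g] ->
  exists x w, let r := (x, true) :: w in
    [/\ R (word_eval q r), word_eval q r <> 1%g &
      forall v, (size v <= size w)%N -> R (word_eval q v) -> word_eval q v = 1%g].
Proof.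
move=> q_surj R_nontrivial; have [R1 RM RV] := nset_subgroup R.
pose Q n := `[< exists w, [/\ size w = n, R (word_eval q w) & word_eval q w <> 1%g] >].
have exQ : exists n, Q n.
  have [r [Rr r1]] : exists r, R r /\ r <> 1%g.
    apply: contrapT => noR; apply: R_nontrivial.
    apply/seteqP; split=> r /=; last by move->.
    by move=> Rr; apply: contrapT => r1; apply: noR; exists r.
  have [w wr] := q_surj r.
  by exists (size w); apply/asboolP; exists w; rewrite wr.
case: (ex_minnP exQ) => n /asboolP[w [wn Rw w1]] n_min.
have short v : (size v < n)%N -> R (word_eval q v) -> word_eval q v = 1%g.
  move=> vn Rv; apply: contrapT => v1.
  have /n_min : Q (size v) by apply/asboolP; exists v.
  by rewrite leqNgt vn.
case: w wn Rw w1 => [|[x b] w] wn Rw w1; first by rewrite /word_eval big_nil in w1.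
have lt_n v : (size v <= size w)%N -> (size v < n)%N by rewrite -wn.
case: b wn Rw w1 => wn Rw w1.
  by exists x, w; split=> // v /lt_n/short; apply.
(* A shortest relator that starts with an inverse letter is rotated, then
   inverted. *)
have evE : word_eval q ((x, true) :: word_inv w) =
    ((word_eval q ((x, false) :: w))^-1 ^ (q x)^-1)%g.
  rewrite !(word_eval_cons _ _ w) (word_eval_cons _ _ (word_inv w)) !word_eval_letter.
  have -> : word_eval q (word_inv w) = (word_eval q w)^-1%g.
    apply/esym/mulg1_eq; rewrite -word_eval_cat.
    rewrite (@word_eval_congr _ _ q (fun _ _ => False) _ _ _ (word_congr_mulV _ w)) //.
    exact: big_nil.
  by rewrite conjgE invgM !invgK !mulgA mulgK.
exists x, (word_inv w); split; rewrite ?evE.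
- by apply: nset_conj; apply: RV.
- by move=> /eqP; rewrite conjg_eq1 invg_eq1 => /eqP.
by move=> v; rewrite /word_inv size_rev size_map => /lt_n/short; apply.
Qed.

(** D is the Fox derivative with respect to the first letter of a shortest relator r. The
    coefficient of D r at 1 cannot vanish, because the path of r in the Cayley graph of G crosses
    the first edge only once. *)
Lemma fox_derivation : is_free_group F -> nset R <> [set 1%g] ->
  exists D : F -> group_algebra (quotient_group R),
    (forall x y, D (x * y)%g = D x + bar x * D y) /\
    exists r, R r /\ D r <> 0.
Proof.
move=> /free_group_eval[X [q [q_surj q_congr]]] R_nontrivial.
have [R1 RM RV] := nset_subgroup R.
have [x0 [w [Rr r1 r_min]]] := minimal_relator q_surj R_nontrivial.
pose q' x := quotient_map R (q x).
have q'E v : word_eval q' v = quotient_map R (word_eval q v).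
  by rewrite word_eval_morph.
have [wd wdK] := choice q_surj.
pose D x := fox_word q' x0 (wd x).
have DE v : D (word_eval q v) = fox_word q' x0 v.
  by apply/fox_word_congr/q_congr; rewrite wdK.
exists D; split=> [x y|].
  by rewrite -{1}[x]wdK -{1}[y]wdK -word_eval_cat DE fox_word_cat q'E wdK.
exists (word_eval q ((x0, true) :: w)); split=> // /(congr1 (mcoeff 1%g)).
rewrite DE /= /fox_letter eqxx galg_coefD galg_coef_mull -galg_elt1.
rewrite galg_coef_elt eqxx galg_coef0 => D1.
have /fox_word_coef[w1 [b [w2 [wE]]]] :
    (fox_word q' x0 w)@_((word_eval q' [:: (x0, true)])^-1 * 1)%g != 0.
  by apply: contra_eq_neq D1 => ->; rewrite addr0 oner_neq0.
rewrite mulg1 => /(congr1 (fun y => (word_eval q' [:: (x0, true)] * y)%g)).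
rewrite mulgV -word_eval_cat q'E => /esym/quotient_map_eq1.
(* The first letter contributes 1 to the coefficient of 1, and any other
   contribution would come from a prefix of the relator lying in R. *)
have cut v v' : w = v' ++ v -> word_eval q ((x0, true) :: v') = 1%g -> False.
  move=> vE v1; apply: r1; rewrite vE -cat_cons word_eval_cat v1 mul1g.
  apply: r_min; first by rewrite vE size_cat leq_addl.
  by move: Rr; rewrite vE -cat_cons word_eval_cat v1 mul1g.
have sw : size w = (size w1 + (size w2).+1)%N by rewrite wE size_cat.
case: b wE => wE Rw1.
  (* A positive crossing: the prefix x0 w1 lies in R and is shorter than the relator, hence
     trivial. *)
  apply: (cut _ _ wE); apply: r_min => //.
  by rewrite /= sw addnS ltnS leq_addr.
(* An inverse crossing: the prefix x0 w1 x0^-1 may be the whole relator, so minimality is applied to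
   its conjugate [w1]. *)
apply: (cut w2 (rcons w1 (x0, false))); first by rewrite cat_rcons.
have Rw1' : R (word_eval q w1).
  suff -> : word_eval q w1 =
      (word_eval q ([:: (x0, true)] ++ rcons w1 (x0, false)) ^ (q x0))%g.
    exact: nset_conj.
  rewrite -cats1 !word_eval_cat !word_eval_letter conjgE.
  by rewrite !mulgA mulVg mul1g mulgVK.
have w1_1 : word_eval q w1 = 1%g by apply: r_min => //; rewrite sw leq_addr.
rewrite -cats1 word_eval_cons word_eval_cat w1_1 mul1g !word_eval_letter.
exact: mulgV.
Qed.

End RelationModule.

(** * Cocycles on HNN extensions and doubles *)

Section HNNCocycle.
Variables (V E : groupType) (a b : E -> V) (W : zmodType).
Local Notation Gamma := (hnn_extension a b).

Definition hnn_vertex (v : V) : Gamma := pres_gen (hnn_rel a b) (inl v).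
Definition hnn_stable : Gamma := pres_gen (hnn_rel a b) (inr tt).

Lemma hnn_vertexM v w : (hnn_vertex (v * w) = hnn_vertex v * hnn_vertex w)%g.
Proof.
have := pres_class_rel (hnn_rel_mul a b v w).
by rewrite !pres_class_cons pres_class_nil !mulg1 => /esym.
Qed.

Lemma hnn_stable_conj e :
  (hnn_stable * hnn_vertex (a e) = hnn_vertex (b e) * hnn_stable)%g.
Proof.
have := pres_class_rel (hnn_rel_conj a b e).
rewrite !pres_class_cons pres_class_nil !mulg1 /= => /(congr1 (fun g => g * hnn_stable)%g).
by rewrite -!mulgA mulVg mulg1.
Qed.

Variables (psi : E -> E -> W) (tau : Gamma -> E).
Hypothesis psi_cocycle : forall x y z,
  psi y z + psi x (y * z)%g = psi (x * y)%g z + psi x y.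
Hypothesis tauM : forall e y, tau (hnn_vertex (a e) * y)%g = (e * tau y)%g.
Hypothesis tau1 : tau 1%g = 1%g.

(* The cup product of the class of [psi], transferred along [tau], with the
   derivation that counts crossings of the stable letter. *)
Lemma hnn_cocycle : exists phi : Gamma -> Gamma -> Gamma -> W,
  [/\ forall w x y z, phi x y z + phi w (x * y)%g z + phi w x y =
                      phi (w * x)%g y z + phi w x (y * z)%g,
      forall v y z, phi (hnn_vertex v) y z = 0
    & forall e e', phi hnn_stable (hnn_vertex (a e)) (hnn_vertex (a e')) =
                   psi e e'].
Proof.
(* Functions constant on the cosets of the edge group, under right translation. Evaluation at 1 on
   the stable letter respects t a(e) t^-1 = b(e) because of this invariance. *)
pose inv (u : Gamma -> W) := forall e y, u (hnn_vertex (a e) * y)%g = u y.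
pose act (g : Gamma) (u : Gamma -> W) := fun y => u (y * g)%g.
pose T0 (x : V + unit) (u : Gamma -> W) := if x is inr _ then u 1%g else 0.
have [||||||T [TM TD Tgen]] := @pres_right_cocycle _ (hnn_rel a b) (Gamma -> W) W
  act inv _ _ _ _ T0.
- by move=> u; apply/funext => y; rewrite /act mulg1.
- by move=> g h u; apply/funext => y; rewrite /act mulgA.
- by [].
- by move=> g u iu e y; rewrite /act -mulgA iu.
- by move=> [v|[]] u u' _ _ /=; rewrite ?addr0.
- move=> _ _ u [v w|e] iu /=; first by rewrite !addr0.
  rewrite /act !addr0 add0r pres_class_cons /= mul1g iu.
  by rewrite pres_class_letter pres_class_nil mul1g mulg1 subrr.
(* The Shapiro transfer of [psi]: its homogeneous form at [tau y], [tau (y * g)], [tau (y * g * h)].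
   Equivariance of [tau] makes it invariant under the edge group. *)
pose xi g h y := psi ((tau y)^-1 * tau (y * g))%g
                     ((tau (y * g))^-1 * tau (y * g * h))%g.
have xi_inv g h : inv (xi g h).
  by move=> e y; rewrite /xi -!mulgA !tauM !invgM -!mulgA !mulKg.
exists (fun g h k => T g (xi h k)); split=> [w x y z|v y z|e e'].
- have xiE : xi (x * y)%g z + xi x y = act x (xi y z) + xi x (y * z)%g.
    apply/funext => g; rewrite !fctE /act /xi !mulgA.
    have := psi_cocycle ((tau g)^-1 * tau (g * x))%g
      ((tau (g * x))^-1 * tau (g * x * y))%g
      ((tau (g * x * y))^-1 * tau (g * x * y * z))%g.
    by rewrite !mulgA !mulgK.
  have xi_act g h k : inv (act g (xi h k)).
    by move=> e u; rewrite /act -mulgA xi_inv.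
  by rewrite -addrA -TD // xiE TD // TM // addrA [T x _ + _]addrC.
- by rewrite Tgen.
rewrite Tgen //= /xi !mul1g tau1 invg1 mul1g tauM -[hnn_vertex (a e)]mulg1 tauM.
by rewrite -[hnn_vertex (a e')]mulg1 tauM tau1 !mulg1 mulKg.
Qed.

End HNNCocycle.

Section DoubleCocycle.
Variables (F : groupType) (R : normal_subgroup F).
Local Notation L := (group_double R).
Local Notation A := (group_algebra (quotient_group R)).
Local Notation bar x := (galg_elt (quotient_map R x)).

Definition double_inl (x : F) : L := pres_gen (double_rel R) (inl x).
Definition double_inr (x : F) : L := pres_gen (double_rel R) (inr x).

Lemma double_inlM x y : double_inl (x * y)%g = (double_inl x * double_inl y)%g.
Proof.
have := pres_class_rel (double_rel_mul1 R x y).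
by rewrite !pres_class_cons pres_class_nil !mulg1 => /esym.
Qed.

Lemma double_inrM x y : double_inr (x * y)%g = (double_inr x * double_inr y)%g.
Proof.
have := pres_class_rel (double_rel_mul2 R x y).
by rewrite !pres_class_cons pres_class_nil !mulg1 => /esym.
Qed.

Lemma double_inl_inr r : R r -> double_inl r = double_inr r.
Proof.
move=> Rr; have := pres_class_rel (double_rel_amalg Rr).
by rewrite !pres_class_cons pres_class_nil !mulg1.
Qed.

Definition double_fold_gen (z : F + F) : F := match z with inl x | inr x => x end.

Lemma double_fold_genP u v :
  double_rel R u v -> word_eval double_fold_gen u = word_eval double_fold_gen v.
Proof. by case=> [x y|x y|r Rr]; rewrite /word_eval !(big_cons, big_nil) /= ?mulg1. Qed.

(** Through this retraction of L onto F, the group L acts on A and D becomes a derivation on L. *)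
Definition double_fold (l : L) : F := pres_lift double_fold_gen l.

HB.instance Definition _ := isUMagmaMorphism.Build L F
  double_fold (pres_lift_is_morphism double_fold_genP).

Lemma double_fold_inl x : double_fold (double_inl x) = x.
Proof. exact: (pres_lift_gen double_fold_genP). Qed.

Lemma double_pi_inl x : double_pi (double_inl x) = quotient_map R x.
Proof. exact: (pres_lift_gen (@double_pi_genP _ R)). Qed.

Lemma double_pi_inr x : double_pi (double_inr x) = 1%g.
Proof. exact: (pres_lift_gen (@double_pi_genP _ R)). Qed.

Variable D : F -> A.
Hypothesis D_derivation : forall x y, D (x * y)%g = D x + bar x * D y.

(* The cup product of [D] with the right derivation into A that vanishes on
   the second copy of F and is inner on the first. *)
Lemma double_cocycle : exists psi : L -> L -> A,
  [/\ forall x y z, psi y z + psi x (y * z)%g = psi (x * y)%g z + psi x y,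
      forall f r, R r -> psi ((double_inr f)^-1 * double_inl f)%g (double_inl r) =
        (1 - bar f) * D r
    & forall r l, R r -> psi (double_inl r) l = 0].
Proof.
pose act (l : L) (u : A) : A := bar (double_fold l) * u.
(* The two prescriptions agree on R, where [1 - bar r = 0]. *)
pose T0 (x : F + F) (u : A) : A := if x is inl f then (1 - bar f) * u else 0.
have actM g h u : act (g * h)%g u = act g (act h u).
  by rewrite /act !gmulfM galg_eltM mulrA.
have act1 u : act 1%g u = u by rewrite /act !gmulf1 mul1r.
have act_letter z u : act (pres_class (double_rel R) [:: (z, true)]) u =
    bar (double_fold_gen z) * u.
  by rewrite /act [double_fold _](pres_lift_gen double_fold_genP).
have [||||T [TM TD Tgen]] := @pres_right_cocycle _ (double_rel R) A A
  act (fun _ => True) act1 actM _ _ T0.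
- by move=> g u v; rewrite /act mulrDr.
- by [].
- by move=> [x|x] u v _ _ /=; rewrite ?mulrDr ?addr0.
- move=> _ _ u [x y|x y|r Rr] _; last by rewrite !word_cocycle1 // /T0
    (quotient_map_eq1 R r).2 // galg_elt1 subrr mul0r.
  + rewrite word_cocycle_cons !word_cocycle1 //.
    rewrite act_letter /T0 [in RHS]gmulfM galg_eltM !mulrBl !mul1r -mulrA.
    by rewrite addrC addrA subrK.
  + by rewrite word_cocycle_cons !word_cocycle1 // addr0.
exists (fun l m => T l (D (double_fold m))); split=> [x y z|f r Rr|r l Rr].
- by rewrite gmulfM D_derivation TD // TM // addrA addrC addrA.
- rewrite double_fold_inl TM // Tgen //= -[RHS]add0r; congr (_ + _).
  have T1 u : T 1%g u = 0.
    by have := TM 1%g 1%g u I; rewrite mulg1 /act gmulf1 mul1r => /eqP; rewrite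
      -subr_eq0 opprD addNKr oppr_eq0 => /eqP.
  (* T vanishes on f_2, hence also on its inverse. *)
  set u := act _ _; have := TM (double_inr f)^-1%g (double_inr f)
    (act (double_inr f)^-1%g u) I.
  by rewrite mulVg -actM mulgV T1 Tgen //= addr0 /act gmulf1 mul1r.
by rewrite double_inl_inr // Tgen.
Qed.

End DoubleCocycle.

(** L acts freely on P through [iota]. Once a representative [c p] is chosen in each orbit, the
    L-coordinate of p relative to it is unique and equivariant. *)
Lemma equivariant_retraction (L P : groupType) (iota : UMagmaMorphism.type L P) :
  injective iota -> exists tau : P -> L,
    (forall l p, tau (iota l * p)%g = (l * tau p)%g) /\ tau 1%g = 1%g.
Proof.
move=> iota_inj.
pose orb (p : P) : set P := [set q | exists l, p = (iota l * q)%g].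
pose c p := xget 1%g (orb p).
have cP p : exists l, p = (iota l * c p)%g.
  by apply: (@xgetPex _ 1%g (orb p)); exists p, 1%g; rewrite gmulf1 mul1g.
have [l lP] := choice cP.
have orbE m p : orb (iota m * p)%g = orb p.
  apply/seteqP; split=> q /= [k kq].
    by exists (m^-1 * k)%g; rewrite gmulfM gmulfV -mulgA -kq mulKg.
  by exists (m * k)%g; rewrite gmulfM -mulgA -kq.
have lM m p : l (iota m * p)%g = (m * l p)%g.
  apply: iota_inj; apply: (mulIg (c p)); rewrite gmulfM -mulgA -lP.
  by have -> : c p = c (iota m * p)%g; [rewrite /c orbE | rewrite -lP].
(* A constant right factor normalises the value at 1 and keeps left equivariance. *)
exists (fun p => l p * (l 1%g)^-1)%g; split=> [m p|]; last exact: mulgV.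
by rewrite lM mulgA.
Qed.

(* Hig acts on the set P x G: the vertex group by left multiplication, the
   stable letter by (p, g) |-> (p, pi (tau p) g). *)
Lemma Hig_retraction (F : groupType) (R : normal_subgroup F) (P : groupType)
    (iota : UMagmaMorphism.type (group_double R) P) : injective iota ->
  exists tau : Hig iota -> group_double R, tau 1%g = 1%g /\
    forall l y, tau (pres_gen _ (inl (iota l, 1%g)) * y)%g = (l * tau y)%g.
Proof.
move=> /equivariant_retraction[tauP [tauPM tauP1]].
pose G := quotient_group R.
pose f (x : P * G + unit) (a : P * G) : P * G :=
  if x is inl v then (v * a)%g else (a.1, double_pi (tauP a.1) * a.2)%g.
pose f' (x : P * G + unit) (a : P * G) : P * G :=
  if x is inl v then (v^-1 * a)%g else (a.1, (double_pi (tauP a.1))^-1 * a.2)%g.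
have [|||act [act1 actM act_gen]] := @pres_action _
  (hnn_rel (fun l => (iota l, 1%g)) (fun l => (iota l, double_pi l))) _ f f'.
- by move=> [v|u] [p g] /=; rewrite mulKg.
- by move=> [v|u] [p g] /=; rewrite mulVKg.
- move=> _ _ [v w [p g]|l [p g]] /=; first by rewrite mulgA.
  (* On the G-coordinate the conjugate by t multiplies by pi(l tau(p)) pi(tau(p))^-1 = pi(l). *)
  by rewrite tauPM gmulfM mul1g -mulgA mulVKg.
exists (fun y => tauP (act y 1%g).1); split=> [|l y]; first by rewrite act1.
by rewrite actM act_gen /= tauPM.
Qed.

(** * Cycles and cocycles of degree 3 in the bar complex *)

(* [bar_diff G n] leaves degree n + 1, which is the degree concerned here. *)
Definition finitely_spanned_homology (G : groupType) (n : nat) : Prop :=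
  exists (m : nat) (w : 'I_m -> bar G n.+1), forall z, bar_diff G n z = 0 ->
    exists (c : 'I_m -> rat) (y : bar G n.+2),
      z = \sum_i c i *: w i + bar_diff G n.+1 y.

(** The cancellation behind [bar_diff_torus_cycle], over abstract variables: the six groups are the
    boundaries of the six shuffles, and the [ACl] pattern pairs each of the 26 terms with its
    opposite. *)
Lemma torus_cancel (V : zmodType) (a b c d u v X K A B C Y Z : V) :
  a - b + X - K - A - (c - d + X - A - K) - ((d - b) - (c - a) - (u - v))
  + (Y - B - C) - (Z - C - B) - (Y - (v - u) - Z) = 0.
Proof.
rewrite !opprD !opprK !addrA.
rewrite (ACl ((1*14)*(2*12)*(3*8)*(4*10)*(5*9)*(6*13)*(7*11)*(15*25)*(16*24)
  *(17*23)*(18*22)*(19*21)*(20*26)))/=.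
by rewrite !(subrr, addNr, addr0).
Qed.

Section LowBar.
Variable G : groupType.

Definition bar_tuple n (s : seq G) : {ffun 'I_n -> G} :=
  [ffun i : 'I_n => nth 1%g s i].

Definition bar2 (x y : G) : bar G 2 := << bar_tuple 2 [:: x; y] >>.
Definition bar3 (x y z : G) : bar G 3 := << bar_tuple 3 [:: x; y; z] >>.
Definition bar4 (w x y z : G) : bar G 4 := << bar_tuple 4 [:: w; x; y; z] >>.

Lemma bar_face_tuple n (k : 'I_n.+2) s s' :
  (forall i, (i < n)%N -> nth 1%g s' i =
     if (i.+1 < k)%N then nth 1%g s i
     else if i.+1 == k then (nth 1 s i * nth 1 s i.+1)%g else nth 1%g s i.+1) ->
  bar_face k (bar_tuple n.+1 s) = bar_tuple n s'.
Proof. by move=> s'E; apply/ffunP => i; rewrite !ffunE s'E. Qed.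

Lemma bar_diff3 x y z : bar_diff G 2 (bar3 x y z) =
  bar2 y z - bar2 (x * y)%g z + bar2 x (y * z)%g - bar2 x y.
Proof.
rewrite [LHS]lin_extU 4!big_ord_recl big_ord0 [X in _ + (_ + (_ + X))]addr0 /=.
rewrite !exprS expr0 !mulr1 !mulrNN ?mulr1 ?scaleN1r ?scale1r !addrA.
rewrite (@bar_face_tuple _ _ _ [:: y; z]); last by case=> [|[|]].
rewrite (@bar_face_tuple _ _ _ [:: (x * y)%g; z]); last by case=> [|[|]].
rewrite (@bar_face_tuple _ _ _ [:: x; (y * z)%g]); last by case=> [|[|]].
by rewrite (@bar_face_tuple _ _ _ [:: x; y]); last by case=> [|[|]].
Qed.

Lemma bar_diff4 w x y z : bar_diff G 3 (bar4 w x y z) =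
  bar3 x y z - bar3 (w * x)%g y z + bar3 w (x * y)%g z - bar3 w x (y * z)%g
  + bar3 w x y.
Proof.
rewrite [LHS]lin_extU 5!big_ord_recl big_ord0 [X in _ + (_ + (_ + (_ + X)))]addr0 /=.
rewrite !exprS expr0 !mulr1 !mulrNN ?mulr1 ?mulrNN ?scaleN1r ?scale1r !addrA.
rewrite (@bar_face_tuple _ _ _ [:: x; y; z]); last by case=> [|[|[|]]].
rewrite (@bar_face_tuple _ _ _ [:: (w * x)%g; y; z]); last by case=> [|[|[|]]].
rewrite (@bar_face_tuple _ _ _ [:: w; (x * y)%g; z]); last by case=> [|[|[|]]].
rewrite (@bar_face_tuple _ _ _ [:: w; x; (y * z)%g]); last by case=> [|[|[|]]].
by rewrite (@bar_face_tuple _ _ _ [:: w; x; y]); last by case=> [|[|[|]]].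
Qed.

Definition cochain3 (W : lmodType rat) (phi : G -> G -> G -> W) :
    {linear bar G 3 -> W} :=
  lin_ext (fun v : {ffun 'I_3 -> G} =>
    phi (v (@Ordinal 3 0 isT)) (v (@Ordinal 3 1 isT)) (v (@Ordinal 3 2 isT))).

Lemma cochain3E W phi x y z : @cochain3 W phi (bar3 x y z) = phi x y z.
Proof. by rewrite [LHS]lin_extU !ffunE. Qed.

Lemma cochain3_boundary (W : lmodType rat) (phi : G -> G -> G -> W) :
    (forall w x y z, phi x y z + phi w (x * y)%g z + phi w x y =
                     phi (w * x)%g y z + phi w x (y * z)%g) ->
  forall c, cochain3 phi (bar_diff G 3 c) = 0.
Proof.
move=> phi_cocycle c; elim/malg_ind: c => [|v|a u v IHu IHv].
- by rewrite !linear0.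
- have -> : << v >> = bar4 (v (@Ordinal 4 0 isT)) (v (@Ordinal 4 1 isT))
      (v (@Ordinal 4 2 isT)) (v (@Ordinal 4 3 isT)).
    congr << _ >>; apply/ffunP => -[[|[|[|[|//]]]] lt_i];
    by rewrite ffunE /=; congr (v _); apply/val_inj.
  rewrite bar_diff4 !(linearD, linearN) /= !cochain3E.
  have := phi_cocycle (v (@Ordinal 4 0 isT)) (v (@Ordinal 4 1 isT))
    (v (@Ordinal 4 2 isT)) (v (@Ordinal 4 3 isT)).
  move: (phi _ _ _) (phi _ _ _) (phi _ _ _) (phi _ _ _) (phi _ _ _) => a b c d e.
  move=> edc; rewrite addrAC (addrAC e) (addrAC (e + d)) edc.
  by rewrite -addrA -opprD subrr.
have -> : bar_diff G 3 (a *: u + v) = a *: bar_diff G 3 u + bar_diff G 3 v :=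
  linearP _ _ _ _.
by rewrite linearP /= IHu IHv scaler0 addr0.
Qed.

Lemma bar_diffD n (x y : bar G n.+1) :
  bar_diff G n (x + y) = bar_diff G n x + bar_diff G n y.
Proof. exact: linearD. Qed.

Lemma bar_diffB n (x y : bar G n.+1) :
  bar_diff G n (x - y) = bar_diff G n x - bar_diff G n y.
Proof. exact: linearB. Qed.

(** When t x = x' t, this is the square with boundary [x] - [x']. For x' = x it is the torus of t
    and x. *)
Definition conj_bar t x x' : bar G 2 := bar2 t x - bar2 x' t.

(* The subdivided prism between [x|y] and [x'|y'], the latter being the
   conjugate of the former by [t]. *)
Definition shuffle t x x' y y' : bar G 3 :=
  bar3 t x y - bar3 x' t y + bar3 x' y' t.

Lemma bar_diff_shuffle t x x' y y' :
  (t * x = x' * t)%g -> (t * y = y' * t)%g ->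
  bar_diff G 2 (shuffle t x x' y y') =
  bar2 x y - bar2 x' y' + conj_bar t (x * y)%g (x' * y')%g
  - conj_bar t x x' - conj_bar t y y'.
Proof.
move=> tx ty; rewrite /shuffle bar_diffD bar_diffB !bar_diff3 tx ty /conj_bar.
move: (bar2 x y) (bar2 (x' * t) y) (bar2 t _) (bar2 t x) (bar2 t y) (bar2 x' _)
  (bar2 x' t) (bar2 y' t) (bar2 _ t) (bar2 x' y') => a b c d e g h i j l.
rewrite !opprD !opprK !addrA.
by rewrite [LHS](ACl (1*12*3*10*4*8*5*9*(2*6)*(7*11)))/= !addNr !addr0.
Qed.

(** The first two terms are the prism over the torus of k and r. The third splits the torus of r and
    k gamma. The last three are the product of gamma with [p|q] - [q|p] - [r|qp], a once-punctured
    torus with boundary - [r] when r q p = p q. *)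
Definition torus_cycle t k r gamma p q : bar G 3 :=
  shuffle t k (k * gamma)%g r r - shuffle t r r k (k * gamma)%g
  - shuffle r k k gamma gamma
  + shuffle gamma p p q q - shuffle gamma q q p p
  - shuffle gamma r r (q * p)%g (q * p)%g.

Lemma bar_diff_shuffle_comm t x y : (t * x = x * t)%g -> (t * y = y * t)%g ->
  bar_diff G 2 (shuffle t x x y y) =
  conj_bar t (x * y)%g (x * y)%g - conj_bar t x x - conj_bar t y y.
Proof. by move=> tx ty; rewrite bar_diff_shuffle // subrr add0r. Qed.

(* The torus [k|r] - [r|k] and its conjugate by [t] differ by the torus of
   [gamma] and [r], which bounds because [r] is the commutator of [p] and [q]. *)
Lemma bar_diff_torus_cycle t k r gamma p q :
  (t * k = k * gamma * t)%g -> (t * r = r * t)%g -> (r * k = k * r)%g ->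
  (r * gamma = gamma * r)%g -> (gamma * p = p * gamma)%g ->
  (gamma * q = q * gamma)%g -> (r * (q * p) = p * q)%g ->
  bar_diff G 2 (torus_cycle t k r gamma p q) = 0.
Proof.
move=> tk tr rk rg gp gq rqp.
have rkg : (r * (k * gamma) = k * gamma * r)%g by rewrite mulgA rk -mulgA rg mulgA.
have gqp : (gamma * (q * p) = q * p * gamma)%g by rewrite mulgA gq -!mulgA gp.
have E : bar_diff G 2 (torus_cycle t k r gamma p q) =
    bar_diff G 2 (shuffle t k (k * gamma)%g r r)
    - bar_diff G 2 (shuffle t r r k (k * gamma)%g)
    - bar_diff G 2 (shuffle r k k gamma gamma)
    + bar_diff G 2 (shuffle gamma p p q q) - bar_diff G 2 (shuffle gamma q q p p)
    - bar_diff G 2 (shuffle gamma r r (q * p)%g (q * p)%g).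
  by rewrite /torus_cycle bar_diffB bar_diffB bar_diffD bar_diffB bar_diffB.
rewrite {}E (bar_diff_shuffle tk tr) (bar_diff_shuffle tr tk).
rewrite (bar_diff_shuffle_comm rk rg) (bar_diff_shuffle_comm gp gq).
rewrite (bar_diff_shuffle_comm gq gp) (bar_diff_shuffle_comm (esym rg) gqp).
rewrite rqp rk rkg; exact: torus_cancel.
Qed.

(** Only the two simplices whose first entry is t survive. *)
Lemma cochain3_torus_cycle (W : lmodType rat) (phi : G -> G -> G -> W)
    t k r gamma p q :
  let A x := forall y z, phi x y z = 0 in
  A k -> A (k * gamma)%g -> A r -> A gamma -> A p -> A q ->
  cochain3 phi (torus_cycle t k r gamma p q) = phi t k r - phi t r k.
Proof.
move=> A phik phikg phir phig phip phiq.
have cD x y : cochain3 phi (x + y) = cochain3 phi x + cochain3 phi y.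
  exact: linearD.
have cB x y : cochain3 phi (x - y) = cochain3 phi x - cochain3 phi y.
  exact: linearB.
have cS u x x' y y' : cochain3 phi (shuffle u x x' y y') =
    phi u x y - phi x' u y + phi x' y' u.
  by rewrite /shuffle cD cB !cochain3E.
rewrite /torus_cycle cB cB cD cB cB !cS !phik !phikg !phir !phig !phip !phiq.
by rewrite !(subr0, addr0).
Qed.

End LowBar.

(** * The third homology of Hig *)

Lemma infinite_fresh (T : choiceType) (S : {fset T}) :
  infinite_set [set: T] -> exists x, x \notin S.
Proof.
move=> T_inf; apply: contrapT => S_full; apply: T_inf.
apply: (@sub_finite_set _ _ [set` S]); last exact: finite_fset.
move=> x _ /=; apply: contrapT => /negP xS; apply: S_full; by exists x.
Qed.

(** If m has a nonzero coefficient at u, choose g with g u outside S and outside the support of m.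
    The coefficient of (1 - g) m at g u is then that of - m at u. *)
Lemma translate_escape (G : groupType) (m : group_algebra G) (S : {fset G}) :
  infinite_set [set: G] -> m <> 0 ->
  exists g u, u \notin S /\ ((1 - galg_elt g) * m)@_u <> 0.
Proof.
move=> G_inf m0.
have [u mu] : exists u, m@_u <> 0.
  apply: contrapT => m_eq0; apply: m0; apply/malgP => u; rewrite mcoeff0.
  by apply: contrapT => mu; apply: m_eq0; exists u.
have [g gS] := infinite_fresh [fset (v * u^-1)%g | v in (S `|` msupp m)]%fset G_inf.
have guS v : v \in (S `|` msupp m)%fset -> (g * u)%g <> v.
  move=> vS guv; move/negP: gS; apply; apply/imfsetP; exists v => //=.
  by rewrite -guv mulgK.
exists g, (g * u)%g; split.
  by apply/negP => guS'; apply: (guS (g * u)%g) => //; rewrite in_fsetU guS'.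
rewrite mulrBl mul1r galg_coefD galg_coefN galg_coef_mull mulKg.
rewrite mcoeff_outdom ?add0r => [/eqP|]; first by rewrite oppr_eq0 => /eqP.
by apply/negP => gum; apply: (guS (g * u)%g) => //; rewrite in_fsetU gum orbT.
Qed.

Lemma finite_support (T : choiceType) (s : seq {malg rat[T]}) :
  exists S : {fset T}, forall x u, x \in s -> u \notin S -> x@_u = 0.
Proof.
elim: s => [|x s [S IH]]; first by exists fset0.
exists (msupp x `|` S)%fset => y u; rewrite in_cons in_fsetU negb_or.
by case/predU1P => [-> /andP[/mcoeff_outdom]|/IH + /andP[_]]; last exact.
Qed.

Section HigHomology.
Variables (F : groupType) (R : normal_subgroup F) (P : groupType).
Variable iota : UMagmaMorphism.type (group_double R) P.
Local Notation L := (group_double R).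
Local Notation G := (quotient_group R).
Local Notation A := (group_algebra G).
Local Notation bar x := (galg_elt (quotient_map R x)).

Lemma double_pi_twist f :
  double_pi ((double_inr R f)^-1 * double_inl R f)%g = quotient_map R f.
Proof.
by rewrite gmulfM /= gmulfV /= double_pi_inr double_pi_inl invg1 mul1g.
Qed.

(** Both copies of f conjugate r to the same element, since f r f^-1 lies in R. *)
Lemma double_commute f r : R r ->
  (double_inl R r * ((double_inr R f)^-1 * double_inl R f) =
   (double_inr R f)^-1 * double_inl R f * double_inl R r)%g.
Proof.
move=> Rr; apply: (mulgI (double_inr R f)).
have Rr' : R (f * r * f^-1)%g.
  by have := nset_conj f^-1%g Rr; rewrite conjgE invgK mulgA.
rewrite -!mulgA mulVKg -double_inlM !mulgA (double_inl_inr Rr) -double_inrM.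
have -> : (f * r = f * r * f^-1 * f)%g by rewrite mulgVK.
rewrite double_inlM (double_inl_inr Rr'); congr (_ * _)%g.
by rewrite double_inrM mulgK.
Qed.

(** Both sides of r r0 h = h r0 are expanded by the product rule, with r and r0 acting trivially on
    A. *)
Lemma derivation_commutator (D : F -> A) h r r0 :
    (forall x y, D (x * y)%g = D x + bar x * D y) ->
    R r -> R r0 -> (r * (r0 * h) = h * r0)%g ->
  D r = (bar h - 1) * D r0.
Proof.
move=> D_der Rr Rr0 rr0h; have barR x : R x -> bar x = 1.
  by move/quotient_map_eq1 ->.
have := D_der r (r0 * h)%g.
rewrite rr0h (D_der h) (D_der r0) (barR _ Rr) (barR _ Rr0) !mul1r addrA (addrC (D h)).
by move=> /addIr hE; rewrite mulrBl mul1r hE addrK.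
Qed.

Hypothesis iota_inj : injective iota.

Lemma Hig_torus_cycle (D : F -> A) :
    (forall x y, D (x * y)%g = D x + bar x * D y) ->
  exists Phi : {linear Defs.bar (Hig iota) 3 -> A},
    (forall c, Phi (bar_diff _ 3 c) = 0) /\
    forall f h r, R r -> exists2 z, bar_diff _ 2 z = 0 &
      Phi z = (1 - bar f) * ((bar h - 1) * D r).
Proof.
move=> D_der.
have [psi [psi_cocycle psi_kr psi_rk]] := double_cocycle D_der.
have [tau [tau1 tauM]] := Hig_retraction iota_inj.
have [phi [phi_cocycle phi_vertex phi_stable]] := hnn_cocycle psi_cocycle tauM tau1.
exists (cochain3 phi); split; first exact: cochain3_boundary.
move=> f h r0 Rr0; have [R1 RM RV] := nset_subgroup R.
have [r Rr rr0h] : exists2 r, R r & (r * (r0 * h) = h * r0)%g.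
  (* The commutator [h, r0]; in the torus cycle h and r0 take the places of p and q. *)
  exists (h * r0 * h^-1 * r0^-1)%g; last by rewrite !mulgA !mulgVK.
  apply: RM; last exact: RV.
  by have := nset_conj h^-1%g Rr0; rewrite conjgE invgK mulgA.
have Dr := derivation_commutator D_der Rr Rr0 rr0h.
pose k := ((double_inr R f)^-1 * double_inl R f)%g.
pose v := @hnn_vertex (P * G)%type L (fun l => (iota l, 1%g))
            (fun l => (iota l, double_pi l)).
pose a l := v (iota l, 1%g).
have vM x y : v (x * y)%g = (v x * v y)%g by apply: hnn_vertexM.
have aM x y : a (x * y)%g = (a x * a y)%g.
  by rewrite /a -vM gmulfM; congr (v (_, _)); rewrite mulg1.
pose gamma := v (1%g, quotient_map R f).
have gammaC x : (gamma * a x = a x * gamma)%g.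
  by rewrite -!vM; congr (v (_, _)); rewrite /= ?mulg1 ?mul1g.
pose t := @hnn_stable (P * G)%type L (fun l => (iota l, 1%g))
            (fun l => (iota l, double_pi l)).
exists (torus_cycle t (a k) (a (double_inl R r)) gamma
  (a (double_inl R h)) (a (double_inl R r0))).
  have tC l : (t * a l = v (iota l, double_pi l) * t)%g.
    exact: hnn_stable_conj.
  apply: bar_diff_torus_cycle; rewrite ?gammaC //.
  (* Since pi(k) is the class of f, the stable letter conjugates [a k] to [a k * gamma]. *)
  - rewrite tC -vM; congr (v (_, _) * _)%g; rewrite /= ?mulg1 // mul1g.
    by rewrite double_pi_twist.
  - by rewrite tC double_pi_inl (quotient_map_eq1 R r).2.
  - by rewrite -!aM double_commute.
  - by rewrite -!aM -!double_inlM rr0h.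
(* What remains is psi(k, r) - psi(r, k), and the second term vanishes because r also lies in the
   second copy of F. *)
rewrite cochain3_torus_cycle ?phi_stable.
  rewrite (psi_kr f r Rr) (psi_rk r _ Rr).
  by rewrite subr0 Dr; reflexivity.
all: try by move=> y z; apply: phi_vertex.
by move=> y z; rewrite -vM; apply: phi_vertex.
Qed.

Lemma Hig_homology3 : is_free_group F -> infinite_set [set: G] ->
  nset R <> [set 1%g] -> ~ finitely_spanned_homology (Hig iota) 2.
Proof.
move=> F_free G_inf R_nontrivial [m [s s_span]].
have [D [D_der [r [Rr Dr]]]] := fox_derivation F_free R_nontrivial.
have [Phi [Phi_bnd Phi_torus]] := Hig_torus_cycle D_der.
(* Nonvanishing of (h - 1) D(r) is the only aim here, so the excluded set is empty. *)
have [h [u [_ hu]]] := translate_escape fset0 G_inf Dr.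
have Dr' : (bar (repr h) - 1) * D r <> 0.
  move=> /(congr1 -%R); rewrite oppr0 -mulNr opprB quotient_mapK => h0.
  by apply: hu; rewrite h0 galg_coef0.
(* S supports [Phi] of every spanning chain, hence of every cycle, as [Phi] kills boundaries. The
   choice of g then produces a cycle whose value leaves S. *)
have [S suppS] := finite_support (codom (fun i => Phi (s i) : {malg rat[G]})).
have [g [w [wS]]] := translate_escape S G_inf Dr'; apply.
have [z z_cycle Phiz] := Phi_torus (repr g) (repr h) r Rr.
rewrite -[g]quotient_mapK -Phiz; have [c [y ->]] := s_span z z_cycle.
rewrite linearD /= Phi_bnd addr0 linear_sum /=.
apply: (big_ind (fun x : {malg rat[G]} => x@_w = 0)) => [|x x' xw x'w|i _].
- exact: mcoeff0.
- by rewrite mcoeffD xw x'w addr0.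
have Phi_i : (Phi (s i) : {malg rat[G]})@_w = 0.
  by apply: suppS => //; apply/codomP; exists i.
by rewrite linearZ_LR /= [LHS]mcoeffZ Phi_i mulr0.
Qed.

End HigHomology.

(** * Comparison of projective resolutions *)

Section ImageModule.
Variables (A : nzRingType) (M N : lmodType A) (p : {linear M -> N}).

Definition image_pred : {pred N} := fun y => `[< exists x, p x = y >].

Lemma image_submod : submod_closed image_pred.
Proof.
split=> [|a u v]; first by apply/asboolP; exists 0; rewrite linear0.
move=> /asboolP[x <-] /asboolP[y <-]; apply/asboolP; exists (a *: x + y).
by rewrite linearP.
Qed.
HB.instance Definition _ :=
  GRing.isSubmodClosed.Build A N image_pred image_submod.

Record image_module := ImageModule {
  image_val :> N;
  _ : image_val \in image_pred
}.
HB.instance Definition _ := [isSub for image_val].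
HB.instance Definition _ := [Choice of image_module by <:].
HB.instance Definition _ := [SubChoice_isSubLmodule of image_module by <:].

Definition to_image (L : lmodType A) (f : {linear L -> N})
    (fP : forall x, f x \in image_pred) (x : L) : image_module :=
  ImageModule (fP x).

Lemma to_image_is_linear L f fP : linear (@to_image L f fP).
Proof. by move=> a u v; apply/val_inj; rewrite /= !linearP. Qed.
HB.instance Definition _ L f fP :=
  GRing.isLinear.Build A L image_module _ (@to_image L f fP)
    (@to_image_is_linear L f fP).

End ImageModule.

(** Projectivity is stated for surjections, so both maps are first corestricted to the image of
    [p]. *)
Lemma projective_lift (A : nzRingType) (P M N : lmodType A)
    (p : {linear M -> N}) (f : {linear P -> N}) :
  projective_module P -> (forall x, exists m, p m = f x) ->
  exists g : {linear P -> M}, forall x, p (g x) = f x.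
Proof.
move=> P_proj f_im.
have pP m : p m \in image_pred p by apply/asboolP; exists m.
have fP x : f x \in image_pred p by apply/asboolP.
have [|g gP] := P_proj _ _ (to_image pP : {linear _ -> _})
                           (to_image fP : {linear _ -> _}).
  move=> [y yP]; have /asboolP[m my] := yP; exists m.
  by apply/val_inj.
by exists g => x; have /(congr1 val) := gP x.
Qed.

Section ComparisonTheorem.
Variables (A : nzRingType) (M : lmodType A).
Implicit Types P Q : projective_resolution M.

(** Taking the augmentation as the differential out of degree 0 merges the two exactness conditions
    into one. *)
Definition res_cycle P i : P i -> Prop :=
  match i with
  | 0 => fun x => res_aug P x = 0
  | j.+1 => fun x => res_diff P j x = 0
  end.

Lemma res_cycleP P i (x : P i) : res_cycle x <-> exists y, res_diff P i y = x.
Proof. by case: i x => [|i] x; [apply: res_exact0 | apply: res_exact]. Qed.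

Lemma comparison_map P Q : exists phi : forall i, {linear P i -> Q i},
  (forall x, res_aug Q (phi 0 x) = res_aug P x) /\
  (forall i x, res_diff Q i (phi i.+1 x) = phi i (res_diff P i x)).
Proof.
(* Preservation of cycles is what the next lift requires, and it keeps the type of the recursion
   independent of the preceding map. *)
pose state i := {phi : {linear P i -> Q i} |
  forall x, res_cycle x -> res_cycle (phi x)}.
have [phi0 phi0P] : exists phi0 : {linear P 0 -> Q 0},
    forall x, res_aug Q (phi0 x) = res_aug P x.
  by apply: projective_lift => [|x]; [apply: res_proj | apply: res_aug_surj].
have step i (s : state i) : {s' : state i.+1 |
    forall x, res_diff Q i (sval s' x) = sval s (res_diff P i x)}.
  case: s => phi phiP /=; apply: cid.
  have [||psi psiP] := @projective_lift _ (P i.+1) (Q i.+1) (Q i)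
      (res_diff Q i) (phi \o res_diff P i).
  - exact: res_proj.
  - by move=> x; apply/res_cycleP/phiP/res_cycleP; exists x.
  have psi_cycle x : res_cycle x -> res_cycle (psi x).
    by move=> /= dx; rewrite psiP /= dx linear0.
  by exists (exist _ psi psi_cycle).
have phi0_cycle x : res_cycle x -> res_cycle (phi0 x).
  by move=> /= x0; rewrite phi0P.
pose s := nat_rect state (exist _ phi0 phi0_cycle) (fun i s => sval (step i s)).
exists (fun i => sval (s i)); split=> [x|i x]; first exact: phi0P.
exact: (svalP (step i (s i))).
Qed.

Lemma comparison_homotopy P Q (D : forall i, {linear P i -> Q i}) :
  (forall x, res_aug Q (D 0 x) = 0) ->
  (forall i x, res_diff Q i (D i.+1 x) = D i (res_diff P i x)) ->
  exists h : forall i, {linear P i -> Q i.+1},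
    forall i x, D i.+1 x = res_diff Q i.+1 (h i.+1 x) + h i (res_diff P i x).
Proof.
move=> D_aug D_diff.
(* On cycles the term involving the preceding homotopy vanishes, so the invariant mentions [h] in a
   single degree. *)
pose state i := {h : {linear P i -> Q i.+1} |
  forall x, res_cycle x -> res_diff Q i (h x) = D i x}.
have [h0 h0P] : exists h0 : {linear P 0 -> Q 1},
    forall x, res_diff Q 0 (h0 x) = D 0 x.
  apply: projective_lift => [|x]; first exact: res_proj.
  by apply/(res_cycleP (i := 0)); apply: D_aug.
have step i (s : state i) : {s' : state i.+1 | forall x,
    D i.+1 x = res_diff Q i.+1 (sval s' x) + sval s (res_diff P i x)}.
  case: s => h hP /=; apply: cid.
  have [||k kP] := @projective_lift _ (P i.+1) (Q i.+2) (Q i.+1)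
      (res_diff Q i.+1) (D i.+1 \- (h \o res_diff P i)).
  - exact: res_proj.
  - move=> x; apply/(res_cycleP (i := i.+1)) => /=.
    rewrite linearB /= D_diff hP ?subrr //.
    by apply/res_cycleP; exists x.
  have k_cycle x : res_cycle x -> res_diff Q i.+1 (k x) = D i.+1 x.
    by move=> /= dx; rewrite kP /= dx linear0 subr0.
  by exists (exist _ k k_cycle) => x /=; rewrite kP /= subrK.
have h0_cycle x : res_cycle x -> res_diff Q 0 (h0 x) = D 0 x by [].
pose s := nat_rect state (exist _ h0 h0_cycle) (fun i s => sval (step i s)).
exists (fun i => sval (s i)) => i x.
exact: (svalP (step i (s i))).
Qed.

End ComparisonTheorem.

(** * The bar resolution *)

Section MalgSum.
Variables (K : choiceType) (U M : zmodType) (S : K -> U -> M).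
Hypothesis SD : forall k, {morph S k : a b / a + b}.

(** Coefficients enter through additive maps [S k]: scalar multiplication for [free_lift], and
    merely additive maps for the contraction of the bar resolution. *)
Definition malg_sum (c : {malg U[K]}) : M := \sum_(k <- msupp c) S k c@_k.

Lemma malg_summand0 k : S k 0 = 0.
Proof. by apply: (@addrI _ (S k 0)); rewrite -SD !addr0. Qed.

Lemma malg_sumEw (d : {fset K}) c :
  (msupp c `<=` d)%fset -> malg_sum c = \sum_(k <- d) S k c@_k.
Proof.
move=> cd; rewrite /malg_sum (big_fset_incl _ cd) //= => k _ /mcoeff_outdom ->.
exact: malg_summand0.
Qed.

Lemma malg_sumD u v : malg_sum (u + v) = malg_sum u + malg_sum v.
Proof.
pose d := (msupp u `|` msupp v)%fset.
rewrite (@malg_sumEw d u) ?fsubsetUl // (@malg_sumEw d v) ?fsubsetUr //.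
rewrite (@malg_sumEw d) ?msuppD_le // -big_split /=.
by apply: eq_bigr => k _; rewrite mcoeffD SD.
Qed.

Lemma malg_sumU a k : malg_sum << a *g k >> = S k a.
Proof.
rewrite (@malg_sumEw [fset k]%fset) ?msuppU_le //.
by rewrite big_seq_fset1 mcoeffUU.
Qed.

Lemma malg_add_ind (Q : {malg U[K]} -> Prop) :
  Q 0 -> (forall u v, Q u -> Q v -> Q (u + v)) ->
  (forall a k, Q << a *g k >>) -> forall c, Q c.
Proof.
move=> Q0 QD QU c; rewrite [c]monalgE; elim/big_rec: _ => // k u _ Qu.
exact: QD.
Qed.

End MalgSum.

Section FreeModule.
Variables (A : nzRingType) (K : choiceType).

Lemma malgZU (a b : A) (k : K) : a *: << b *g k >> = << (a * b) *g k >>.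
Proof. by apply/malgP => k'; rewrite mcoeffZ !mcoeffU mulrnAr. Qed.

Lemma free_ind (Q : {malg A[K]} -> Prop) :
  Q 0 -> (forall k, Q << k >>) ->
  (forall a u v, Q u -> Q v -> Q (a *: u + v)) -> forall c, Q c.
Proof.
move=> Q0 QU QD; apply: malg_add_ind => // [u v Qu Qv|a k].
  by rewrite -[u]scale1r; apply: QD.
by rewrite -[a]mulr1 -malgZU -[_ *: _]addr0; apply: QD.
Qed.

Section Lift.
Variables (M : lmodType A) (f : K -> M).

Definition free_lift : {malg A[K]} -> M := malg_sum (fun k a => a *: f k).

Lemma free_lift_is_linear : linear free_lift.
Proof.
have SD k : {morph (fun a => a *: f k) : a b / a + b} by move=> a b; rewrite scalerDl.
move=> a u v; rewrite /free_lift malg_sumD //; congr (_ + _).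
apply: (@malg_add_ind K A (fun u =>
  malg_sum (fun k b => b *: f k) (a *: u) =
  a *: malg_sum (fun k b => b *: f k) u)) => [|x y IHx IHy|b k].
- by rewrite scaler0 /malg_sum msupp0 !big_seq_fset0 scaler0.
- by rewrite scalerDr !malg_sumD // scalerDr IHx IHy.
by rewrite malgZU !malg_sumU // scalerA.
Qed.
HB.instance Definition _ :=
  GRing.isLinear.Build A {malg A[K]} M _ free_lift free_lift_is_linear.

Lemma free_liftU k : free_lift << k >> = f k.
Proof.
rewrite /free_lift malg_sumU ?scale1r // => k' a b; exact: scalerDl.
Qed.

End Lift.

Lemma free_module_projective : projective_module ({malg A[K]} : lmodType A).
Proof.
move=> M N p f p_surj.
have [g gP] := choice (fun k => p_surj (f << k >>)).
exists (free_lift g : {linear _ -> _}) => x.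
elim/free_ind: x => [|k|a u v IHu IHv]; first by rewrite !linear0.
  by rewrite /= free_liftU.
by rewrite !linearP IHu IHv.
Qed.

End FreeModule.

Section BarCons.
Variable G : groupType.

Definition ffun_cons n (g : G) (k : {ffun 'I_n -> G}) : {ffun 'I_n.+1 -> G} :=
  [ffun i => if unlift ord0 i is Some j then k j else g].

Lemma ffun_cons0 n g (k : {ffun 'I_n -> G}) : ffun_cons g k ord0 = g.
Proof. by rewrite ffunE unlift_none. Qed.

Lemma ffun_consS n g (k : {ffun 'I_n -> G}) i : ffun_cons g k (lift ord0 i) = k i.
Proof. by rewrite ffunE liftK. Qed.

Lemma ffun_cons_eta n (k : {ffun 'I_n.+1 -> G}) :
  k = ffun_cons (k ord0) [ffun i => k (lift ord0 i)].
Proof.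
apply/ffunP => i; case: (unliftP ord0 i) => [j|] ->.
  by rewrite ffun_consS ffunE.
by rewrite ffun_cons0.
Qed.

Lemma widen_lift0 n (j : 'I_n) :
  widen_ord (leqnSn n.+1) (lift ord0 j) = lift ord0 (widen_ord (leqnSn n) j).
Proof. exact/val_inj. Qed.

(** The contraction prepends an entry to a tuple, so its homotopy identity rests on the faces of
    such tuples. *)
Lemma bar_face_cons0 n g (k : {ffun 'I_n -> G}) :
  bar_face ord0 (ffun_cons g k) = k.
Proof. by apply/ffunP => i; rewrite ffunE /= ffun_consS. Qed.

Lemma bar_face_cons1 n g (k : {ffun 'I_n.+1 -> G}) :
  bar_face (lift ord0 ord0) (ffun_cons g k) =
  ffun_cons (g * k ord0)%g (bar_face ord0 k).
Proof.
apply/ffunP => i; rewrite [LHS]ffunE !ffun_consS /=.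
case: (unliftP ord0 i) => [j|] ->.
  by rewrite ffun_consS [RHS]ffunE.
rewrite ffun_cons0 /=; congr (_ * _)%g.
by have -> : widen_ord (leqnSn n.+1) ord0 = ord0; [apply/val_inj | rewrite ffun_cons0].
Qed.

Lemma bar_face_consS n g (k : {ffun 'I_n.+1 -> G}) (i : 'I_n.+1) :
  bar_face (lift ord0 (lift ord0 i)) (ffun_cons g k) =
  ffun_cons g (bar_face (lift ord0 i) k).
Proof.
apply/ffunP => j; rewrite [LHS]ffunE !ffun_consS.
case: (unliftP ord0 j) => [j'|] ->.
  by rewrite ffun_consS [RHS]ffunE widen_lift0 ffun_consS.
rewrite ffun_cons0 /=.
by have -> : widen_ord (leqnSn n.+1) ord0 = ord0; [apply/val_inj | rewrite ffun_cons0].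
Qed.

End BarCons.

Section BarResolution.
Variable G : groupType.
Local Notation A := (group_algebra G).
Local Notation K n := {ffun 'I_n -> G}.

Definition free_bar n : lmodType A := {malg A[K n]}.

Definition basis n (k : K n) : free_bar n := << k >>.

Lemma basisZ n x (k : K n) : x *: basis k = << x *g k >>.
Proof. by rewrite [LHS]malgZU mulr1. Qed.

Definition free_bar_diff n : {linear free_bar n.+1 -> free_bar n} :=
  free_lift (fun k : K n.+1 =>
    galg_elt (k ord0) *: basis (bar_face ord0 k) +
    \sum_(i < n.+1) (-1) ^+ i.+1 *: basis (bar_face (lift ord0 i) k)).

Definition free_bar_aug : {linear free_bar 0 -> trivial_module G} :=
  free_lift (fun _ : K 0 => 1 : trivial_module G).

Lemma galg_scale1 (a : rat) (x : A) : (a *: (1 : A) : A) * x = a *: x.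
Proof.
have := galg_mulPl a 1 0 x; rewrite addr0 galg_mul0l addr0.
by rewrite -[galg_mul 1 x]/(1 * x) mul1r.
Qed.

Lemma augmentationZ (a : rat) (x : A) : augmentation (a *: x) = a * augmentation x.
Proof. by rewrite -[a *: x]addr0 augmentationP augmentation0 addr0. Qed.

Lemma free_bar_ind n (Q : free_bar n -> Prop) :
  Q 0 -> (forall u v, Q u -> Q v -> Q (u + v)) ->
  (forall a g k, Q ((a *: galg_elt g : A) *: basis k)) ->
  forall c, Q c.
Proof.
move=> Q0 QD QU; apply: malg_add_ind => // x k.
rewrite -basisZ; elim/malg_add_ind: x => [|u v Qu Qv|a g]; first by rewrite scale0r.
  by rewrite scalerDl; apply: QD.
have -> : << a *g g >> = a *: galg_elt g by rewrite [RHS]malgZU mulr1.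
exact: QU.
Qed.

(** The usual contraction g [k] |-> [g|k], extended over Q. A rational number acts as [a *: 1]
    because [free_bar] is a module over A. *)
Definition free_bar_section n (k : K n) (x : A) : free_bar n.+1 :=
  malg_sum (fun (g : G) (a : rat) => (a *: (1 : A) : A) *: basis (ffun_cons g k)) x.

Lemma free_bar_section_subproof n (k : K n) (g : G) :
  {morph (fun a : rat => (a *: (1 : A) : A) *: basis (ffun_cons g k)) :
    a b / a + b}.
Proof. by move=> a b; rewrite !scalerDl. Qed.

Lemma free_bar_sectionD n (k : K n) : {morph free_bar_section k : x y / x + y}.
Proof. by move=> x y; apply: malg_sumD; apply: free_bar_section_subproof. Qed.

Definition free_bar_contraction n : free_bar n -> free_bar n.+1 :=
  malg_sum (@free_bar_section n).
Local Notation s := (@free_bar_contraction _).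

Lemma free_bar_contractionD n (x y : free_bar n) : s (x + y) = s x + s y.
Proof. exact/malg_sumD/free_bar_sectionD. Qed.

Lemma free_bar_contractionU n a g (k : K n) :
  s ((a *: galg_elt g : A) *: basis k) =
  (a *: (1 : A) : A) *: basis (ffun_cons g k).
Proof.
rewrite basisZ /free_bar_contraction malg_sumU; last first.
  exact: free_bar_sectionD.
rewrite /free_bar_section [X in malg_sum _ X]malgZU mulr1 malg_sumU //.
exact: free_bar_section_subproof.
Qed.

Lemma free_bar_contraction0 n : s (0 : free_bar n) = 0.
Proof. by apply: (@addrI _ (s 0)); rewrite -free_bar_contractionD !addr0. Qed.

Lemma scale_sign (M : lmodType A) n (x : M) :
  (-1) ^+ n *: x = if odd n then - x else x.
Proof. by rewrite -signr_odd scaler_sign. Qed.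

Lemma free_bar_contractionN n (x : free_bar n) : s (- x) = - s x.
Proof.
by apply: (@addrI _ (s x)); rewrite -free_bar_contractionD !subrr free_bar_contraction0.
Qed.

Lemma scale_signC (M : lmodType A) (c : A) n (x : M) :
  c *: ((-1) ^+ n *: x) = (-1) ^+ n *: (c *: x).
Proof. by rewrite !scale_sign; case: (odd n); rewrite ?scalerN. Qed.

Lemma scale_cancel (M : lmodType A) (c : A) (x y z y' z' : M) :
  y' = c *: y -> z' = c *: z -> c *: (x - (y + z)) + (y' + z') = c *: x.
Proof. by move=> -> ->; rewrite -!scalerDr subrK. Qed.

Lemma free_bar_contraction_sign n m (x : free_bar n) :
  s ((-1) ^+ m *: x) = (-1) ^+ m *: s x.
Proof.
by rewrite scale_sign [RHS]scale_sign; case: (odd m); rewrite ?free_bar_contractionN.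
Qed.

Lemma free_bar_contraction_sum n m (F : 'I_m -> free_bar n) :
  s (\sum_i F i) = \sum_i s (F i).
Proof.
apply: (big_morph (@free_bar_contraction n)).
  exact: free_bar_contractionD.
exact: free_bar_contraction0.
Qed.

Lemma free_bar_diffU n (k : K n.+1) : free_bar_diff n (basis k) =
  galg_elt (k ord0) *: basis (bar_face ord0 k) +
  \sum_(i < n.+1) (-1) ^+ i.+1 *: basis (bar_face (lift ord0 i) k).
Proof. exact: free_liftU. Qed.

Lemma free_bar_augU (k : K 0) : free_bar_aug (basis k) = 1.
Proof. exact: free_liftU. Qed.

(* Unification would otherwise unfold these modules down to finitely supported
   functions. *)
#[local] Opaque free_bar basis free_bar_diff free_bar_contraction.

(** The subtracted bracket is s(g d[k]), so this is the homotopy identity on g [k]. *)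
Lemma free_bar_diff_cons n g (k : K n.+1) :
  free_bar_diff n.+1 (basis (ffun_cons g k)) = galg_elt g *: basis k
  - (basis (ffun_cons (g * k ord0)%g (bar_face ord0 k)) +
     \sum_(i < n.+1) (-1) ^+ i.+1 *: basis (ffun_cons g (bar_face (lift ord0 i) k))).
Proof.
rewrite free_bar_diffU ffun_cons0 bar_face_cons0; congr (_ + _).
rewrite big_ord_recl bar_face_cons1 expr1 scaleN1r opprD; congr (_ + _).
rewrite -sumrN; apply: eq_bigr => i _; rewrite bar_face_consS.
by rewrite [_ ^+ (lift ord0 i).+1]exprS mulN1r scaleNr.
Qed.

Lemma free_bar_diffD n (x y : free_bar n.+1) :
  free_bar_diff n (x + y) = free_bar_diff n x + free_bar_diff n y.
Proof. exact: linearD. Qed.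

Lemma free_bar_diffZ n c (x : free_bar n.+1) :
  free_bar_diff n (c *: x) = c *: free_bar_diff n x.
Proof. exact: linearZ. Qed.

Lemma free_bar_homotopy n (x : free_bar n.+1) :
  free_bar_diff n.+1 (s x) + s (free_bar_diff n x) = x.
Proof.
elim/free_bar_ind: x => [|u v IHu IHv|a g k].
- by rewrite linear0 !free_bar_contraction0 linear0 addr0.
- rewrite free_bar_diffD !free_bar_contractionD free_bar_diffD addrACA.
  by congr (_ + _); [exact: IHu | exact: IHv].
have E0 : s ((a *: galg_elt g : A) *:
      (galg_elt (k ord0) *: basis (bar_face ord0 k))) =
    (a *: (1 : A) : A) *: basis (ffun_cons (g * k ord0)%g (bar_face ord0 k)).
  by rewrite scalerA -(galg_scale1 a) -mulrA -galg_eltM galg_scale1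
    free_bar_contractionU.
have E1 : s ((a *: galg_elt g : A) *: \sum_(i < n.+1)
      (-1) ^+ i.+1 *: basis (bar_face (lift ord0 i) k)) =
    (a *: (1 : A) : A) *: \sum_(i < n.+1) (-1) ^+ i.+1 *:
      basis (ffun_cons g (bar_face (lift ord0 i) k)).
  rewrite !scaler_sumr free_bar_contraction_sum; apply: eq_bigr => i _.
  rewrite scale_signC free_bar_contraction_sign free_bar_contractionU.
  exact: (esym (scale_signC _ _ _)).
have E2 : (a *: (1 : A) : A) *: (galg_elt g *: basis k) =
    (a *: galg_elt g : A) *: basis k.
  rewrite scalerA galg_scale1; reflexivity.
rewrite free_bar_contractionU !free_bar_diffZ free_bar_diff_cons free_bar_diffU.
rewrite [in X in _ + X]scalerDr free_bar_contractionD.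
exact: (etrans (scale_cancel _ E0 E1) E2).
Qed.

End BarResolution.

Lemma linear_comp_eq0 (R : nzRingType) (L M N : lmodType R)
    (g : {linear L -> M}) (f : {linear M -> N}) a u v :
  f (g u) = 0 -> f (g v) = 0 -> f (g (a *: u + v)) = 0.
Proof. by move=> fgu fgv; rewrite !linearP /= fgu fgv scaler0 addr0. Qed.

Section BarExact.
Variable G : groupType.
Local Notation A := (group_algebra G).
Local Notation K n := {ffun 'I_n -> G}.
Local Notation s := (@free_bar_contraction _ _).
Local Notation d n := (@free_bar_diff G n).
#[local] Opaque free_bar basis free_bar_diff free_bar_contraction free_bar_aug.

Lemma free_bar_basis_ind n (Q : free_bar G n -> Prop) :
  Q 0 -> (forall k, Q (basis k)) ->
  (forall a u v, Q u -> Q v -> Q (a *: u + v)) -> forall c, Q c.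
Proof. exact: free_ind. Qed.

Lemma basis_contraction n (k : K n.+1) :
  basis k = s (galg_elt (k ord0) *: basis [ffun i => k (lift ord0 i)]).
Proof.
rewrite -[galg_elt _]scale1r free_bar_contractionU !scale1r.
by rewrite -ffun_cons_eta.
Qed.

Lemma free_bar_augD x y :
  @free_bar_aug G (x + y) = free_bar_aug G x + free_bar_aug G y.
Proof. exact: linearD. Qed.

Lemma free_bar_augZ c x : @free_bar_aug G (c *: x) = c *: free_bar_aug G x.
Proof. exact: linearZ. Qed.

Lemma free_bar_diff0_cons g (k : K 0) :
  d 0 (basis (ffun_cons g k)) = galg_elt g *: basis k - basis k.
Proof.
rewrite free_bar_diffU big_ord1 ffun_cons0 bar_face_cons0 expr1 scaleN1r.
by congr (_ - basis _); apply/ffunP; case.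
Qed.

Lemma free_bar_aug_diff x : @free_bar_aug G (d 0 x) = 0.
Proof.
elim/free_bar_basis_ind: x => [|k|a u v IHu IHv].
- by rewrite !linear0.
- rewrite [k]ffun_cons_eta free_bar_diff0_cons linearB free_bar_augZ.
  rewrite free_bar_augU; apply/eqP; rewrite subr_eq0; apply/eqP.
  exact: (etrans (congr1 (fun a => a * 1) (augmentation_elt _)) (mul1r _)).
exact: (linear_comp_eq0 (g := d 0) (f := @free_bar_aug G) a IHu IHv).
Qed.

(** The part of the contraction in degree -1, a rational section of the augmentation. *)
Definition aug_section (q : trivial_module G) : free_bar G 0 :=
  ((q : rat) *: (1 : A) : A) *: basis [ffun => 1%g].

Lemma aug_sectionD p q : aug_section (p + q) = aug_section p + aug_section q.
Proof. by rewrite /aug_section !scalerDl. Qed.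

Lemma free_bar_homotopy0 x : d 0 (s x) + aug_section (free_bar_aug G x) = x.
Proof.
elim/free_bar_ind: x => [|u v IHu IHv|a g k].
- by rewrite linear0 free_bar_contraction0 linear0 add0r /aug_section !scale0r.
- rewrite free_bar_contractionD free_bar_diffD free_bar_augD aug_sectionD addrACA.
  by congr (_ + _); [exact: IHu | exact: IHv].
have augE : free_bar_aug G ((a *: galg_elt g : A) *: basis k) = a.
  rewrite free_bar_augZ free_bar_augU.
  have : augmentation (a *: galg_elt g : A) * 1 = a.
    by rewrite augmentationZ augmentation_elt !mulr1.
  exact.
rewrite augE free_bar_contractionU free_bar_diffZ free_bar_diff0_cons.
have -> : aug_section a = (a *: (1 : A) : A) *: basis k.
  by congr (_ *: basis _); apply/ffunP; case.
by rewrite scalerBr subrK scalerA galg_scale1.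
Qed.

Lemma contraction_cycle0 x : free_bar_aug G x = 0 -> d 0 (s x) = x.
Proof.
move=> x0; rewrite -[RHS]free_bar_homotopy0 x0 /aug_section !scale0r addr0.
reflexivity.
Qed.

Lemma contraction_cycle n x : d n x = 0 -> d n.+1 (s x) = x.
Proof.
move=> x0; rewrite -[RHS]free_bar_homotopy x0 free_bar_contraction0 addr0.
reflexivity.
Qed.

(** The contraction replaces the simplicial identities: d d s y = d y - d s (d y), and d s fixes d
    y, which is a cycle by induction. *)
Lemma free_bar_diff_diff n x : d n (d n.+1 x) = 0.
Proof.
(* The image of the contraction generates each module above degree 0. *)
have lin m : (forall y : free_bar G m.+1, d m (d m.+1 (s y)) = 0) ->
    forall y, d m (d m.+1 y) = 0.
  move=> ds; elim/free_bar_basis_ind => [|k|a u v IHu IHv].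
  - by rewrite !linear0.
  - by rewrite basis_contraction ds.
  exact: (linear_comp_eq0 (g := d m.+1) (f := d m) a IHu IHv).
have diffB m (y z : free_bar G m.+1) : d m (y - z) = d m y - d m z.
  exact: linearB.
have ds_y m (y : free_bar G m.+1) : d m.+1 (s y) = y - s (d m y).
  by apply: (addIr (s (d m y))); rewrite free_bar_homotopy subrK.
elim: n x => [|n IH]; apply: lin => y; rewrite ds_y diffB; apply/eqP;
  rewrite subr_eq0; apply/eqP/esym.
  exact/contraction_cycle0/free_bar_aug_diff.
exact/contraction_cycle/IH.
Qed.

Lemma bar_resolution_exact0 x :
  free_bar_aug G x = 0 <-> exists y, d 0 y = x.
Proof.
split=> [x0|[y <-]]; last exact: free_bar_aug_diff.
exists (s x); exact: contraction_cycle0.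
Qed.

Lemma bar_resolution_exact n x : d n x = 0 <-> exists y, d n.+1 y = x.
Proof.
split=> [x0|[y <-]]; last exact: free_bar_diff_diff.
exists (s x); exact: contraction_cycle.
Qed.

Lemma bar_resolution_aug_surj : Defs.surjective (@free_bar_aug G).
Proof.
move=> q; exists (aug_section q); rewrite free_bar_augZ free_bar_augU.
have : augmentation ((q : rat) *: (1 : A) : A) * 1 = q.
  by rewrite augmentationZ augmentation1 !mulr1.
exact.
Qed.

Lemma free_bar_projective n : projective_module (free_bar G n).
Proof. exact: free_module_projective. Qed.

Definition bar_resolution : projective_resolution (trivial_module G) :=
  ProjRes free_bar_projective bar_resolution_aug_surj
    bar_resolution_exact0 bar_resolution_exact.

End BarExact.

(** * Finiteness properties and homology *)

(** V with G acting trivially, so that A-linear maps into it factor through coinvariants. *)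
Definition aug_module (G : groupType) (V : lmodType rat) : Type := V.

Section AugModule.
Variables (G : groupType) (V : lmodType rat).
Local Notation A := (group_algebra G).
HB.instance Definition _ := GRing.Zmodule.on (aug_module G V).

Definition aug_scale (x : A) (v : aug_module G V) : aug_module G V :=
  augmentation x *: (v : V).

Lemma aug_scaleA x y v : aug_scale x (aug_scale y v) = aug_scale (x * y) v.
Proof. by rewrite /aug_scale augmentationM scalerA. Qed.
Lemma aug_scale1 : left_id 1 aug_scale.
Proof. by move=> v; rewrite /aug_scale augmentation1 scale1r. Qed.
Lemma aug_scaleDr : right_distributive aug_scale +%R.
Proof. by move=> x u v; apply: scalerDr. Qed.
Lemma aug_scaleDl v : {morph aug_scale^~ v : x y / x + y}.
Proof. by move=> x y; rewrite /aug_scale augmentationD scalerDl. Qed.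

HB.instance Definition _ := GRing.Zmodule_isLmodule.Build A (aug_module G V)
  aug_scaleA aug_scale1 aug_scaleDr aug_scaleDl.
End AugModule.

(** * The bar complex as coinvariants of the bar resolution *)

Section Coinvariants.
Variable G : groupType.
Local Notation A := (group_algebra G).
Local Notation K n := {ffun 'I_n -> G}.

Definition coinv n (x : free_bar G n) : bar G n :=
  free_lift (M := aug_module G (bar G n)) (fun k : K n => << k >>) x.

Lemma coinvU n (k : K n) : coinv (basis k) = << k >>.
Proof.
exact: (@free_liftU A (K n) (aug_module G (bar G n)) (fun k : K n => << k >>) k).
Qed.

Lemma coinvP n a (x y : free_bar G n) :
  coinv (a *: x + y) = augmentation a *: coinv x + coinv y.
Proof.
exact: (linearP (free_lift (M := aug_module G (bar G n)) (fun k : K n => << k >>))).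
Qed.

#[local] Opaque free_bar basis free_bar_diff coinv.

Lemma coinvD n (x y : free_bar G n) : coinv (x + y) = coinv x + coinv y.
Proof. by rewrite -[x]scale1r coinvP augmentation1 !scale1r. Qed.

Lemma coinv0 n : coinv (0 : free_bar G n) = 0.
Proof. by apply: (@addrI _ (coinv 0)); rewrite -coinvD !addr0. Qed.

Lemma coinvZ n a (x : free_bar G n) : coinv (a *: x) = augmentation a *: coinv x.
Proof. by rewrite -[_ *: x]addr0 coinvP coinv0 addr0. Qed.

Lemma coinvN n (x : free_bar G n) : coinv (- x) = - coinv x.
Proof. by apply: (@addrI _ (coinv x)); rewrite -coinvD !subrr coinv0. Qed.

Lemma coinv_sign n m (x : free_bar G n) :
  coinv ((-1) ^+ m *: x) = (-1) ^+ m *: coinv x.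
Proof.
rewrite scale_sign -[in RHS]signr_odd scaler_sign.
by case: (odd m); rewrite ?coinvN.
Qed.

Lemma coinv_sum n m (F : 'I_m -> free_bar G n) :
  coinv (\sum_i F i) = \sum_i coinv (F i).
Proof. apply: (big_morph (@coinv n)); [exact: coinvD | exact: coinv0]. Qed.

Lemma coinv_surj n (z : bar G n) : exists x, coinv x = z.
Proof.
elim/malg_ind: z => [|k|a u v [x xu] [y yv]].
- by exists 0; apply: coinv0.
- by exists (basis k); apply: coinvU.
exists ((a *: (1 : A) : A) *: x + y); rewrite coinvP xu yv.
rewrite augmentationZ augmentation1 mulr1; reflexivity.
Qed.

(** Functoriality of coinvariants: the composite of [coinv] and [phi] factors through [coinv], by
    the values of [phi] on the basis. *)
Lemma coinv_linear_eq0 n m (phi : {linear free_bar G n -> free_bar G m}) x :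
  coinv x = 0 -> coinv (phi x) = 0.
Proof.
suff -> : coinv (phi x) = lin_ext (fun k => coinv (phi (basis k))) (coinv x).
  by move=> ->; apply: linear0.
elim/free_bar_basis_ind: x => [|k|a u v IHu IHv].
- rewrite linear0 !coinv0; exact/esym/linear0.
- rewrite coinvU; exact/esym/lin_extU.
have -> : phi (a *: u + v) = a *: phi u + phi v by exact: linearP.
rewrite !coinvP IHu IHv; exact/esym/linearP.
Qed.

Lemma coinv_diff n (x : free_bar G n.+1) :
  coinv (free_bar_diff G n x) = bar_diff G n (coinv x).
Proof.
elim/free_bar_basis_ind: x => [|k|a u v IHu IHv].
- rewrite linear0 !coinv0; exact/esym/linear0.
- rewrite coinvU free_bar_diffU coinvD coinvZ augmentation_elt coinvU coinv_sum.
  rewrite [RHS]lin_extU [RHS]big_ord_recl expr0; congr (_ + _).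
  by apply: eq_bigr => i _; rewrite coinv_sign coinvU.
have -> : free_bar_diff G n (a *: u + v) =
    a *: free_bar_diff G n u + free_bar_diff G n v by exact: linearP.
have -> : bar_diff G n (coinv (a *: u + v)) =
    augmentation a *: bar_diff G n (coinv u) + bar_diff G n (coinv v).
  rewrite coinvP; exact: linearP.
rewrite -IHu -IHv; exact: coinvP.
Qed.

(** The composite g f through P is homotopic to the identity of the bar resolution, so every cycle
    is homologous to its image, which comes from the generators of P in degree n + 1. *)
Lemma type_FP_Q_spanned n : type_FP_Q n.+1 G -> finitely_spanned_homology G n.
Proof.
move=> [P P_fg]; have [p p_gen] := P_fg n.+1 (leqnn _).
pose B := bar_resolution G.
have [f [f_aug f_diff]] := comparison_map B P.
have [g [g_aug g_diff]] := comparison_map P B.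
pose D i : {linear B i -> B i} := (g i \o f i) \- idfun.
have [||h hP] := @comparison_homotopy _ _ B B D.
- by move=> x; rewrite linearB /= g_aug f_aug subrr.
- by move=> i x; rewrite linearB /= g_diff f_diff.
exists (size p), (fun i => coinv (g n.+1 p`_i)) => z z_cycle.
have [x xz] := coinv_surj z.
have [c fx] := p_gen (f n.+1 x).
exists (fun i => augmentation (c i)), (- coinv (h n.+1 x)).
(* The lift x need not be a cycle; only the coinvariants of its boundary vanish, and [h] preserves
   this. *)
have hd0 : coinv (h n (free_bar_diff G n x)) = 0.
  by apply: coinv_linear_eq0; rewrite coinv_diff xz.
have gfx : coinv (g n.+1 (f n.+1 x)) =
    \sum_i augmentation (c i) *: coinv (g n.+1 p`_i).
  rewrite fx linear_sum coinv_sum; apply: eq_bigr => i _.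
  by rewrite linearZ_LR coinvZ.
have DE : coinv (D n.+1 x) = coinv (g n.+1 (f n.+1 x)) - z.
  rewrite -xz -coinvN; exact: coinvD.
have hE : coinv (D n.+1 x) = bar_diff G n.+1 (coinv (h n.+1 x)).
  rewrite hP coinvD hd0 addr0; exact: coinv_diff.
rewrite -gfx; move: hE; rewrite DE => hE.
by rewrite [bar_diff _ _ _]linearN /= -hE opprB addrC subrK.
Qed.

(** The spanning chains are representatives of a finite spanning family of classes. *)
Lemma finite_dimensional_spanned n :
  finite_dimensional (group_homology G n.+1) -> finitely_spanned_homology G n.
Proof.
pose proj := quotient_module_proj (@bar_boundary_submod G n.+1).
move=> [s s_gen]; exists (size s), (fun i => val (repr s`_i)) => z z_cycle.
have z_in : z \in @bar_cycle G n.+1 by rewrite unfold_in; apply/eqP.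
have [c cE] := s_gen (proj (BarCycles z_in)).
have projE : proj (\sum_i c i *: repr s`_i) = \sum_i c i *: s`_i.
  have projD u v : proj (u + v) = proj u + proj v.
    exact: quotient_module_projD.
  have proj0 : proj 0 = 0 by apply: (@addrI _ (proj 0)); rewrite -projD !addr0.
  rewrite (big_morph proj projD proj0); apply: eq_bigr => i _.
  rewrite -[in RHS](quotient_module_projK s`_i).
  exact/esym/quotient_scaleE.
move: cE; rewrite -projE => /quotient_module_projP/asboolP[y yE].
exists c, y; rewrite yE linearB linear_sum /= addrC.
have -> : \sum_i c i *: val (repr s`_i) = \sum_i val (c i *: repr s`_i) by [].
by rewrite subrK.
Qed.

End Coinvariants.

Theorem theorem2 (F : groupType) (F_free : is_free_group F)
    (F_fg : finitely_generated_group F)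
    (R : normal_subgroup F)
    (P : groupType) (P_fg : finitely_generated_group P)
    (iota : UMagmaMorphism.type (group_double R) P) (iota_inj : injective iota)
    (G_infinite : infinite_set [set: quotient_group R])
    (R_nontrivial : nset R <> [set 1%g]) :
  ~ finite_dimensional (group_homology (Hig iota) 3) /\
  ~ type_FP_Q 3 (Hig iota).
Proof.
(* Index 2 means degree 3, and either finiteness property would give a finite spanning family
   there. *)
have not_spanned := Hig_homology3 iota_inj F_free G_infinite R_nontrivial.
by split=> [/finite_dimensional_spanned|/type_FP_Q_spanned].
Qed.
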